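(* Let $f:\mathbb R\to\mathbb R$ be a smooth, odd, $2\pi$-periodic function, and let $\delta=(E,f)$ be the perturbation data on $(S^2\times I,\{a,b,c,d\}\times I)$, $I=[0,1]$, described in the context. Then the map $$P\to R_\delta(S^2\times I,\{a,b,c,d\}\times I)$$ induced by the inclusion $S^2\times\{0\}\to S^2\times I$ is a homeomorphism, and the composite $$P\to R_\delta(S^2\times I,\{a,b,c,d\}\times I)\to R(S^2\times\{0,1\},\{a,b,c,d\}\times\{0,1\})=P\times P$$ is the graph of the self homeomorphism (smooth away from the corners) of the pillowcase $$c_\delta:P\to P,\qquad c_\delta(\gamma,\theta)=(\gamma,\theta+2f(\gamma+\pi)).$$ Using the 1-parameter family of perturbations $tf$, $t\in[0,1]$, gives an isotopy from the identity $Id:P\to P$ to $c_\delta:P\to P$.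
   Context: $SU(2)$ is the group of unit quaternions; ''traceless'' means purely imaginary. $R(A,B)$ is the space of conjugacy classes of representations $\pi_1(A\setminus B)\to SU(2)$ sending meridians of $B$ to traceless elements. Pillowcase: $P=\mathbb R^2/G$, $G$ generated by $(\gamma,\theta)\mapsto(\gamma+2\pi,\theta)$, $(\gamma,\theta)\mapsto(\gamma,\theta+2\pi)$, $(\gamma,\theta)\mapsto(-\gamma,-\theta)$; corners are the images of $(\pi\mathbb Z)^2$. With $\pi_1(S^2\setminus\{a,b,c,d\})=\langle a,b,c,d\mid ba=cd\rangle$, $P\cong R(S^2,\{a,b,c,d\})$ via $(\gamma,\theta)\mapsto(a\mapsto\mathbf i,\ b\mapsto e^{\gamma\mathbf k}\mathbf i,\ c\mapsto e^{\theta\mathbf k}\mathbf i,\ d\mapsto e^{(\theta-\gamma)\mathbf k}\mathbf i)$. Perturbation: let $e\subset S^2\setminus\{a,b,c,d\}$ be a simple closed curve separating $\{a,b\}$ from $\{c,d\}$, representing the class $ba=cd$, and let $E:S^1\times D^2\to (S^2\setminus\{a,b,c,d\})\times I$ be a tubular neighborhood of the curve obtained by pushing $e$ into the interior of $S^2\times I$. The group $\pi_1(S^2\times I\setminus(\{a,b,c,d\}\times I\cup E))$ is generated by the meridians $a,b,c,d$ of the punctures in $S^2\times\{0\}$ and the meridian $\mu_E$ of $E$; the longitude of $E$ is $\lambda_E=ba$; and the corresponding meridians of the punctures in $S^2\times\{1\}$ are $a'=a$, $b'=b$, $c'=\mu_Ec\mu_E^{-1}$, $d'=\mu_Ed\mu_E^{-1}$.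 $R_\delta(S^2\times I,\{a,b,c,d\}\times I)$ is the space of conjugacy classes of representations $\rho$ of this group in $SU(2)$ sending $a,b,c,d$ to traceless elements and satisfying: $\rho(\lambda_E)=e^{\alpha Q}$ implies $\rho(\mu_E)=e^{f(\alpha)Q}$ ($Q$ a purely imaginary unit quaternion). The second map restricts representations to the two boundary components. *)

(* Defs.v *)
From HB Require Import structures.
From Stdlib Require Import Relation_Operators.
From mathcomp Require Import all_boot all_order all_algebra.
From mathcomp Require Import generic_quotient ring.
From mathcomp Require Import all_classical all_reals all_analysis.

Set Implicit Arguments.
Unset Strict Implicit.
Unset Printing Implicit Defensive.

Import Order.TTheory GRing.Theory Num.Theory.
Import numFieldNormedType.Exports.

Local Open Scope classical_set_scope.
Local Open Scope quotient_scope.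
Local Open Scope ring_scope.

Definition homeomorphism (T U : topologicalType) (g : T -> U) : Prop :=
  continuous g /\
  exists h : U -> T, [/\ continuous h, cancel g h & cancel h g].

Definition isotopy (R : realType) (T : topologicalType)
    (g0 g1 : T -> T) (H : R -> T -> T) : Prop :=
  [/\ {within [set z : R * T | 0 <= z.1 <= 1],
         continuous (fun z : R * T => H z.1 z.2)},
      forall t : R, 0 <= t <= 1 -> homeomorphism (H t),
      H 0 = g0
    & H 1 = g1].

(* In finite dimension, x |-> 'd F x is C^m iff x |-> 'd F x v is C^m for each
   v, so this is the usual class C^n on an open set U. *)
Fixpoint Ck_on (R : realType) (V W : normedModType R) (n : nat)
    (U : set V) (F : V -> W) : Prop :=
  match n with
  | 0%N => forall x, U x -> {for x, continuous F}
  | m.+1 => (forall x, U x -> differentiable F x) /\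
            (forall v, Ck_on m U (fun x => 'd F x v))
  end.

Definition smooth_on (R : realType) (V W : normedModType R)
    (U : set V) (F : V -> W) : Prop := forall n, Ck_on n U F.

(* [(s, true)] is the letter s and [(s, false)] its formal inverse *)
Definition word (S : Type) := seq (S * bool).

Section Presentation.
Variables (S : choiceType) (rels : set (word S * word S)).

Inductive pres_eq : word S -> word S -> Prop :=
| pres_refl u : pres_eq u u
| pres_sym u v : pres_eq u v -> pres_eq v u
| pres_trans v u w : pres_eq u v -> pres_eq v w -> pres_eq u w
| pres_cat u u' v v' :
    pres_eq u u' -> pres_eq v v' -> pres_eq (u ++ v) (u' ++ v')
| pres_cancel s b : pres_eq [:: (s, b); (s, ~~ b)] [::]
| pres_rel r : rels r -> pres_eq r.1 r.2.

Let preqb (u v : word S) : bool := `[< pres_eq u v >].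

Local Lemma preqb_refl : reflexive preqb.
Proof. by move=> u; apply/asboolP; exact: pres_refl. Qed.

Local Lemma preqb_sym : symmetric preqb.
Proof. by move=> u v; apply/asboolP/asboolP => /pres_sym. Qed.

Local Lemma preqb_trans : transitive preqb.
Proof.
by move=> v u w /asboolP uv /asboolP vw; apply/asboolP/(pres_trans uv vw).
Qed.

Definition pres_equiv := EquivRel preqb preqb_refl preqb_sym preqb_trans.

Definition presented : Type := {eq_quot pres_equiv}.
HB.instance Definition _ := Quotient.on presented.
HB.instance Definition _ := Choice.on presented.

Lemma presP u v : pres_eq u v <-> \pi_presented u = \pi_presented v.
Proof.
split=> [uv|/eqmodP/asboolP //]; by apply/eqmodP/asboolP.
Qed.

Definition winv (u : word S) : word S := rev [seq (x.1, ~~ x.2) | x <- u].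

Lemma pres_winvl u : pres_eq (winv u ++ u) [::].
Proof.
elim: u => [|[s b] u IH]; first exact: pres_refl.
have -> : winv ((s, b) :: u) ++ (s, b) :: u =
          winv u ++ ([:: (s, ~~ b); (s, ~~ ~~ b)] ++ u).
  by rewrite negbK /winv /= rev_cons cat_rcons.
apply: (pres_trans _ IH); apply: pres_cat; first exact: pres_refl.
rewrite -[X in pres_eq _ X]cat0s.
by apply: pres_cat; [exact: pres_cancel|exact: pres_refl].
Qed.

Lemma winvK : involutive winv.
Proof.
move=> u; rewrite /winv map_rev revK -map_comp map_id_in //.
by case=> s b _ /=; rewrite negbK.
Qed.

Lemma pres_winvr u : pres_eq (u ++ winv u) [::].
Proof. by rewrite -{1}[u]winvK; exact: pres_winvl. Qed.

Lemma pres_winv u v : pres_eq u v -> pres_eq (winv u) (winv v).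
Proof.
move=> uv; apply: (@pres_trans ((winv u ++ v) ++ winv v)).
  rewrite -catA -{1}[winv u]cats0; apply: pres_cat; first exact: pres_refl.
  exact/pres_sym/pres_winvr.
rewrite -{2}[winv v]cat0s; apply: pres_cat; last exact: pres_refl.
apply: pres_trans (pres_winvl u); apply: pres_cat; first exact: pres_refl.
exact: pres_sym.
Qed.

Let pone : presented := \pi_presented [::].
Let pinv (x : presented) : presented := \pi_presented (winv (repr x)).
Let pmul (x y : presented) : presented := \pi_presented (repr x ++ repr y).

Local Lemma pres_repr u : pres_eq (repr (\pi_presented u)) u.
Proof. by apply/presP; rewrite reprK. Qed.

Local Lemma pmulE u v :
  pmul (\pi_presented u) (\pi_presented v) = \pi_presented (u ++ v).
Proof. by apply/presP; apply: pres_cat; exact: pres_repr. Qed.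

Local Lemma pinvE u : pinv (\pi_presented u) = \pi_presented (winv u).
Proof. by apply/presP; apply: pres_winv; exact: pres_repr. Qed.

Local Lemma pres_piP (x : presented) : exists u, x = \pi_presented u.
Proof. by exists (repr x); rewrite reprK. Qed.

Local Lemma pmulA : associative pmul.
Proof.
move=> x y z; have [u ->] := pres_piP x; have [v ->] := pres_piP y.
by have [w ->] := pres_piP z; rewrite !pmulE catA.
Qed.

Local Lemma pmul1g : left_id pone pmul.
Proof. by move=> x; have [u ->] := pres_piP x; rewrite pmulE. Qed.

Local Lemma pmulg1 : right_id pone pmul.
Proof. by move=> x; have [u ->] := pres_piP x; rewrite pmulE cats0. Qed.

Local Lemma pmulVg : left_inverse pone pinv pmul.
Proof.
by move=> x; have [u ->] := pres_piP x; rewrite pinvE pmulE; apply/presP/pres_winvl.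
Qed.

Local Lemma pmulgV : right_inverse pone pinv pmul.
Proof.
by move=> x; have [u ->] := pres_piP x; rewrite pinvE pmulE; apply/presP/pres_winvr.
Qed.

HB.instance Definition _ :=
  isGroup.Build presented pmulA pmul1g pmulg1 pmulVg pmulgV.

Definition pres_gen (s : S) : presented := \pi_presented [:: (s, true)].

Lemma pres_piM u v :
  (\pi_presented u * \pi_presented v)%g = \pi_presented (u ++ v).
Proof. exact: pmulE. Qed.

Section Lift.
Variables (G : groupType) (g : S -> G).

Definition weval (u : word S) : G :=
  foldr (fun x y => (if x.2 then g x.1 else (g x.1)^-1) * y)%g 1%g u.

Lemma weval_cat u v : weval (u ++ v) = (weval u * weval v)%g.
Proof. by elim: u => [|x u IH] /=; rewrite ?mul1g// IH mulgA. Qed.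

(* A homomorphism extending g as soon as g satisfies the relations *)
Definition pres_lift (x : presented) : G := weval (repr x).

Hypothesis grel : forall r, rels r -> weval r.1 = weval r.2.

Lemma weval_eq u v : pres_eq u v -> weval u = weval v.
Proof.
elim=> {u v} [//|u v _ -> //|v u w _ -> _ -> //|u u' v v' _ uu _ vv|s b|].
- by rewrite !weval_cat uu vv.
- by case: b; rewrite /= mulg1 ?mulgV ?mulVg.
- exact: grel.
Qed.

Lemma pres_lift_pi u : pres_lift (\pi_presented u) = weval u.
Proof. exact/weval_eq/pres_repr. Qed.

Lemma pres_lift_gen s : pres_lift (pres_gen s) = g s.
Proof. by rewrite pres_lift_pi /= mulg1. Qed.

Lemma pres_lift_morphism : monoid.monoid_morphism pres_lift.
Proof.
split=> [|x y]; first exact: (pres_lift_pi [::]).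
have [u ->] := pres_piP x; have [v ->] := pres_piP y.
by rewrite pres_piM !pres_lift_pi weval_cat.
Qed.

End Lift.

Lemma weval_conj (G : groupType) (g h : S -> G) (c : G) :
  (forall s, h s = c * g s * c^-1)%g ->
  forall u, weval h u = (c * weval g u * c^-1)%g.
Proof.
move=> hg; elim=> [|[s b] u IH] /=; first by rewrite mulg1 mulgV.
by rewrite IH hg; case: b; rewrite ?invgM ?invgK !mulgA mulgVK.
Qed.

End Presentation.

(* The library does not declare products as pointed topological spaces, which
   is what lim needs. *)
HB.saturate prod.

(* (x, y, z, w) is x + y i + z j + w k; the multiplication of quaternions is
   qmul, not the componentwise one. *)
Notation quat R := (R * R * R * R)%type.

Section Quaternions.
Variable R : realType.

Definition mkquat (x y z w : R) : quat R := (x, y, z, w).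
Definition qre (q : quat R) : R := q.1.1.1.
Definition qim_i (q : quat R) : R := q.1.1.2.
Definition qim_j (q : quat R) : R := q.1.2.
Definition qim_k (q : quat R) : R := q.2.

Definition q1 : quat R := mkquat 1 0 0 0.
Definition qi : quat R := mkquat 0 1 0 0.
Definition qk : quat R := mkquat 0 0 0 1.

Definition qmul (p q : quat R) : quat R :=
  let: (a, b, c, d) := p in let: (x, y, z, w) := q in
  mkquat (a * x - b * y - c * z - d * w)
         (a * y + b * x + c * w - d * z)
         (a * z - b * w + c * x + d * y)
         (a * w + b * z - c * y + d * x).

Definition qconj (q : quat R) : quat R :=
  let: (x, y, z, w) := q in mkquat x (- y) (- z) (- w).

Definition qnormsq (q : quat R) : R :=
  qre q ^+ 2 + qim_i q ^+ 2 + qim_j q ^+ 2 + qim_k q ^+ 2.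

Definition qexp (q : quat R) : quat R :=
  limn (series (fun n => n`!%:R^-1 *: iter n (qmul q) q1)).

Definition imag_unit (q : quat R) : Prop := qre q = 0 /\ qnormsq q = 1.

Definition SU2 : Type := set_type [set q : quat R | qnormsq q = 1].
HB.instance Definition _ := SubChoice.on SU2.
HB.instance Definition _ := Topological.on SU2.

Definition mkSU2 (q : quat R) (hq : qnormsq q = 1) : SU2 := SigSub (mem_set hq).

Lemma SU2P (q : SU2) : qnormsq (val q) = 1.
Proof. exact: (set_mem (valP q)). Qed.

Lemma qnormsqM p q : qnormsq (qmul p q) = qnormsq p * qnormsq q.
Proof.
case: p => [[[a b] c] d]; case: q => [[[x y] z] w].
by rewrite /qnormsq /qre /qim_i /qim_j /qim_k /=; ring.
Qed.

Lemma qnormsq_conj q : qnormsq (qconj q) = qnormsq q.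
Proof.
by case: q => [[[x y] z] w]; rewrite /qnormsq /qre /qim_i /qim_j /qim_k /= !sqrrN.
Qed.

Lemma qnormsq1 : qnormsq q1 = 1.
Proof. by rewrite /qnormsq /qre /qim_i /qim_j /qim_k /=; ring. Qed.

Lemma qmulA : associative qmul.
Proof.
move=> [[[a b] c] d] [[[a1 b1] c1] d1] [[[x y] z] w].
by congr (_, _, _, _); ring.
Qed.

Lemma qmul1q : left_id q1 qmul.
Proof. by move=> [[[x y] z] w]; congr (_, _, _, _); ring. Qed.

Lemma qmulq1 : right_id q1 qmul.
Proof. by move=> [[[x y] z] w]; congr (_, _, _, _); ring. Qed.

Lemma qmul_conjl q : qnormsq q = 1 -> qmul (qconj q) q = q1.
Proof.
case: q => [[[x y] z] w] h.
rewrite /q1 -h /qnormsq /qre /qim_i /qim_j /qim_k /=; congr (_, _, _, _); ring.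
Qed.

Lemma qmul_conjr q : qnormsq q = 1 -> qmul q (qconj q) = q1.
Proof.
case: q => [[[x y] z] w] h.
rewrite /q1 -h /qnormsq /qre /qim_i /qim_j /qim_k /=; congr (_, _, _, _); ring.
Qed.

Local Lemma SU2mulP (p q : SU2) : qnormsq (qmul (val p) (val q)) = 1.
Proof. by rewrite qnormsqM !SU2P mulr1. Qed.
Local Lemma SU2invP (p : SU2) : qnormsq (qconj (val p)) = 1.
Proof. by rewrite qnormsq_conj SU2P. Qed.

Definition SU2one : SU2 := mkSU2 qnormsq1.
Definition SU2mul (p q : SU2) : SU2 := mkSU2 (SU2mulP p q).
Definition SU2inv (p : SU2) : SU2 := mkSU2 (SU2invP p).

Local Lemma SU2mulA : associative SU2mul.
Proof. by move=> p q r; apply: val_inj; exact: qmulA. Qed.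
Local Lemma SU2mul1g : left_id SU2one SU2mul.
Proof. by move=> p; apply: val_inj; exact: qmul1q. Qed.
Local Lemma SU2mulg1 : right_id SU2one SU2mul.
Proof. by move=> p; apply: val_inj; exact: qmulq1. Qed.
Local Lemma SU2mulVg : left_inverse SU2one SU2inv SU2mul.
Proof. by move=> p; apply: val_inj; exact/qmul_conjl/SU2P. Qed.
Local Lemma SU2mulgV : right_inverse SU2one SU2inv SU2mul.
Proof. by move=> p; apply: val_inj; exact/qmul_conjr/SU2P. Qed.

HB.instance Definition _ :=
  isGroup.Build SU2 SU2mulA SU2mul1g SU2mulg1 SU2mulVg SU2mulgV.

Lemma val_SU2M (p q : SU2) : val (p * q)%g = qmul (val p) (val q).
Proof. by []. Qed.

Lemma val_SU2V (p : SU2) : val (p^-1)%g = qconj (val p).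
Proof. by []. Qed.

Lemma val_SU21 : val (1%g : SU2) = q1.
Proof. by []. Qed.

Definition traceless (q : SU2) : Prop := qre (val q) = 0.

Lemma traceless_conj (p q : SU2) : traceless q -> traceless (p * q * p^-1)%g.
Proof.
rewrite /traceless !val_SU2M val_SU2V.
case: (val p) => [[[a b] c] d]; case: (val q) => [[[x y] z] w].
by rewrite /qre /= => ->; ring.
Qed.

Lemma imag_unit_sqr Q : imag_unit Q -> qmul Q Q = - q1.
Proof.
case: Q => [[[x y] z] w]; rewrite /imag_unit /qnormsq /qre /qim_i /qim_j /qim_k /=.
move=> [-> h]; rewrite /q1 /mkquat /=.
have -> : - ((1, 0, 0, 0) : quat R) =
  (- (0 ^+ 2 + y ^+ 2 + z ^+ 2 + w ^+ 2), 0, 0, 0) :> quat R.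
  by rewrite h; congr (_, _, _, _); rewrite ?oppr0.
by congr (_, _, _, _); ring.
Qed.

Lemma qmulDr p q r : qmul p (q + r) = qmul p q + qmul p r.
Proof.
case: p => [[[p0 p2] p3] p4]; case: q => [[[x y] z] w]; case: r => [[[x' y'] z'] w'].
by congr (_, _, _, _); rewrite /=; ring.
Qed.

Lemma qmulZl (a : R) p q : qmul (a *: p) q = a *: qmul p q.
Proof.
case: p => [[[p0 p2] p3] p4]; case: q => [[[x y] z] w].
by congr (_, _, _, _); rewrite /= /GRing.scale /=; ring.
Qed.

Lemma qmulZr (a : R) p q : qmul p (a *: q) = a *: qmul p q.
Proof.
case: p => [[[p0 p2] p3] p4]; case: q => [[[x y] z] w].
by congr (_, _, _, _); rewrite /= /GRing.scale /=; ring.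
Qed.

Lemma qexp_imag (a : R) (Q : quat R) :
  imag_unit Q -> qexp (a *: Q) = cos a *: q1 + sin a *: Q.
Proof.
move=> hQ.
have powE n : iter n (qmul (a *: Q)) q1 =
    ((~~ odd n)%:R * (-1) ^+ n./2 * a ^+ n) *: q1 +
    ((odd n)%:R * (-1) ^+ n.-1./2 * a ^+ n) *: Q.
  elim: n => [|n IH]; first by rewrite /= !mul1r !mul0r scale1r scale0r addr0.
  rewrite iterS IH qmulZl qmulDr !qmulZr qmulq1 imag_unit_sqr// scalerN.
  rewrite -scaleNr scalerDr !scalerA addrC.
  case: n {IH} => [|n]; first by rewrite /= !(mul0r, mul1r, oppr0, mulr0, mulr1).
  set c1 := (X in X *: q1 + _); set c2 := (X in _ + X *: Q).
  rewrite (_ : c1 = (~~ odd n.+2)%:R * (-1) ^+ n.+2./2 * a ^+ n.+2); last first.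
    rewrite {}/c1 {c2} /= negbK (exprS _ n.+1) (exprS _ n./2).
    by case: odd => /=; ring.
  rewrite (_ : c2 = (odd n.+2)%:R * (-1) ^+ n.+1./2 * a ^+ n.+2) //.
  rewrite {c1} /c2 /= negbK (exprS _ n.+1) uphalf_half.
  by case: odd => /=; ring.
have serE : series (fun n => n`!%:R^-1 *: iter n (qmul (a *: Q)) q1) =
    (fun n => series (cos_coeff a) n *: q1 + series (sin_coeff a) n *: Q).
  apply/funext => n; rewrite /series /= !scaler_suml -big_split /=.
  apply: eq_bigr => k _; rewrite powE scalerDr !scalerA /cos_coeff /sin_coeff /=.
  by rewrite ![k`!%:R^-1 * _]mulrC.
have hc : (series (cos_coeff a) n *: (q1 : quat R)) @[n --> \oo] --> cos a *: q1.
  by apply: cvgZr_tmp; rewrite unlock; exact: is_cvg_series_cos_coeff.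
have hs : (series (sin_coeff a) n *: Q) @[n --> \oo] --> sin a *: Q.
  by apply: cvgZr_tmp; rewrite unlock; exact: is_cvg_series_sin_coeff.
rewrite /qexp serE; apply: cvg_lim; last exact: cvgD hc hs.
exact: norm_hausdorff.
Qed.

Lemma imag_unit_qi : imag_unit qi.
Proof. by split; rewrite /qnormsq /qre /qim_i /qim_j /qim_k //=; ring. Qed.

Lemma imag_unit_qk : imag_unit qk.
Proof. by split; rewrite /qnormsq /qre /qim_i /qim_j /qim_k //=; ring. Qed.

Lemma qexp_kE (t : R) : qexp (t *: qk) = mkquat (cos t) 0 0 (sin t).
Proof.
rewrite qexp_imag; last exact: imag_unit_qk.
by congr (_, _, _, _); rewrite /= /GRing.scale /= ?(mulr0, mulr1, addr0, add0r).
Qed.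

Local Lemma qexp_k_norm (t : R) : qnormsq (qexp (t *: qk)) = 1.
Proof.
rewrite qexp_kE /qnormsq /qre /qim_i /qim_j /qim_k /= -(cos2Dsin2 t).
by rewrite expr0n /= !addr0.
Qed.

Definition SU2_i : SU2 := mkSU2 imag_unit_qi.2.
Definition SU2_expk (t : R) : SU2 := mkSU2 (qexp_k_norm t).

End Quaternions.

Section RepresentationSpaces.
Variables (R : realType) (G : groupType).

(* For a finitely generated G, pointwise convergence on G is the topology
   induced by evaluation on any finite generating set. *)
Definition rep_set (C : set (G -> SU2 R)) : set {ptws G -> SU2 R} :=
  [set rho | monoid.monoid_morphism rho /\ C rho].

Variable C : set (G -> SU2 R).

Definition reps : Type := set_type (rep_set C).
HB.instance Definition _ := Choice.on reps.
HB.instance Definition _ := Topological.on reps.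

Definition mkrep (rho : G -> SU2 R) (hrho : rep_set C rho) : reps :=
  SigSub (mem_set hrho).

Lemma repP (rho : reps) : rep_set C (val rho).
Proof. exact: (set_mem (valP rho)). Qed.

Definition conjugate (rho sigma : G -> SU2 R) : Prop :=
  exists g : SU2 R, forall x, sigma x = (g * rho x * g^-1)%g.

Let conjb (rho sigma : reps) : bool := `[< conjugate (val rho) (val sigma) >].

Local Lemma conjb_refl : reflexive conjb.
Proof.
by move=> rho; apply/asboolP; exists 1%g => x; rewrite mul1g invg1 mulg1.
Qed.

Lemma conjugate_sym rho sigma : conjugate rho sigma -> conjugate sigma rho.
Proof.
case=> g h; exists (g^-1)%g => x.
by rewrite h invgK !mulgA mulVg mul1g mulgVK.
Qed.

Local Lemma conjb_sym : symmetric conjb.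
Proof. by move=> rho sigma; apply/asboolP/asboolP => /conjugate_sym. Qed.

Local Lemma conjb_trans : transitive conjb.
Proof.
move=> sigma rho tau /asboolP[g hg] /asboolP[h hh]; apply/asboolP.
by exists (h * g)%g => x; rewrite hh hg invgM !mulgA.
Qed.

Definition conj_equiv := EquivRel conjb conjb_refl conjb_sym conjb_trans.

Definition rep_space : Type := {eq_quot conj_equiv}.
HB.instance Definition _ :=
  Topological.copy rep_space (quotient_topology {eq_quot conj_equiv}).
HB.instance Definition _ := Quotient.on rep_space.

Definition rep_class (rho : reps) : rep_space := \pi_rep_space rho.

Lemma rep_classP (rho sigma : reps) :
  rep_class rho = rep_class sigma <-> conjugate (val rho) (val sigma).
Proof. by split=> [/eqmodP/asboolP //|h]; apply/eqmodP/asboolP. Qed.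

Lemma rep_classK (x : rep_space) : rep_class (repr x) = x.
Proof. exact: reprK. Qed.

End RepresentationSpaces.

Section Restriction.
Variables (R : realType) (G H : groupType) (phi : G -> H).
Variables (C : set (G -> SU2 R)) (D : set (H -> SU2 R)).
Hypothesis phiM : monoid.monoid_morphism phi.
Hypothesis phiC : forall rho, monoid.monoid_morphism rho -> D rho -> C (rho \o phi).

Local Lemma restrict_subproof (rho : reps D) : rep_set C (val rho \o phi).
Proof.
have [rhoM rhoD] := repP rho; split; last exact: phiC.
by split=> [|x y] /=; rewrite ?phiM.1 ?rhoM.1// phiM.2 rhoM.2.
Qed.

Definition rep_restrict (rho : reps D) : reps C := mkrep (restrict_subproof rho).

Definition restrict (x : rep_space D) : rep_space C :=
  rep_class (rep_restrict (repr x)).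

Lemma restrict_class (rho : reps D) :
  restrict (rep_class rho) = rep_class (rep_restrict rho).
Proof.
apply/rep_classP; have [g h] := (rep_classP _ _).1 (rep_classK (rep_class rho)).
by exists g => x /=; exact: h.
Qed.

End Restriction.

Section Pillowcase.
Variable R : realType.

Inductive pillow_step (x : R * R) : R * R -> Prop :=
| pillow_fst : pillow_step x (x.1 + 2 * pi, x.2)
| pillow_snd : pillow_step x (x.1, x.2 + 2 * pi)
| pillow_opp : pillow_step x (- x.1, - x.2).

(* The orbits of the group generated by the three maps above *)
Definition pillow_eq : R * R -> R * R -> Prop :=
  clos_refl_sym_trans (R * R) pillow_step.

Let pilb (x y : R * R) : bool := `[< pillow_eq x y >].

Local Lemma pilb_refl : reflexive pilb.
Proof. by move=> x; apply/asboolP; exact: rst_refl. Qed.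

Local Lemma pilb_sym : symmetric pilb.
Proof. by move=> x y; apply/asboolP/asboolP => h; exact: rst_sym. Qed.

Local Lemma pilb_trans : transitive pilb.
Proof.
by move=> y x z /asboolP xy /asboolP yz; apply/asboolP; exact: rst_trans xy yz.
Qed.

Definition pillow_equiv := EquivRel pilb pilb_refl pilb_sym pilb_trans.

Definition pillowcase : Type := {eq_quot pillow_equiv}.
HB.instance Definition _ :=
  Topological.copy pillowcase (quotient_topology {eq_quot pillow_equiv}).
HB.instance Definition _ := Quotient.on pillowcase.

Definition pillow (gamma theta : R) : pillowcase := \pi_pillowcase (gamma, theta).

Lemma pillowP (x y : R * R) :
  pillow x.1 x.2 = pillow y.1 y.2 <-> pillow_eq x y.
Proof.
rewrite /pillow -!surjective_pairing.
by split=> [/eqmodP/asboolP //|h]; apply/eqmodP/asboolP.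
Qed.

Definition corner : set pillowcase :=
  [set p | exists m n : int, p = pillow (m%:~R * pi) (n%:~R * pi)].

(* The complement of the corners is a smooth surface for which the projection
   from R^2 minus (pi Z)^2 is a local diffeomorphism; a self-map of it is
   therefore smooth iff it lifts locally to smooth maps of the plane. *)
Definition smooth_off_corners (g : pillowcase -> pillowcase) : Prop :=
  forall x : R * R, ~ corner (pillow x.1 x.2) ->
    ~ corner (g (pillow x.1 x.2)) /\
    exists (U : set (R * R)) (F : R * R -> R * R),
      [/\ open U, U x, smooth_on U F
        & forall y, U y -> pillow (F y).1 (F y).2 = g (pillow y.1 y.2)].

End Pillowcase.

Inductive puncture := pa | pb | pc | pd.
HB.instance Definition _ := gen_eqMixin puncture.
HB.instance Definition _ := gen_choiceMixin puncture.

Inductive sphere_rel : set (word puncture * word puncture) :=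
| rel_bacd : sphere_rel ([:: (pb, true); (pa, true)], [:: (pc, true); (pd, true)]).

(* pi_1 of S^2 minus the four punctures *)
Definition sphere_group : groupType := presented sphere_rel.
Definition mer (p : puncture) : sphere_group := pres_gen sphere_rel p.

Inductive generator := gen_mer of puncture | gen_mu.
HB.instance Definition _ := gen_eqMixin generator.
HB.instance Definition _ := gen_choiceMixin generator.

(* The van Kampen presentation obtained by cutting the complement of the tube E
   along S^2 x {1/2}: <a, b, c, d, mu | ba = cd, mu (ba) = (ba) mu>. *)
Inductive product_rel : set (word generator * word generator) :=
| rel_bottom : product_rel
    ([:: (gen_mer pb, true); (gen_mer pa, true)],
     [:: (gen_mer pc, true); (gen_mer pd, true)])
| rel_torus : product_rel
    ([:: (gen_mu, true); (gen_mer pb, true); (gen_mer pa, true)],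
     [:: (gen_mer pb, true); (gen_mer pa, true); (gen_mu, true)]).

(* pi_1 of S^2 x I minus the four arcs and the tube E *)
Definition product_group : groupType := presented product_rel.
Definition merE (p : puncture) : product_group := pres_gen product_rel (gen_mer p).
Definition muE : product_group := pres_gen product_rel gen_mu.
Definition lambdaE : product_group := (merE pb * merE pa)%g.

Definition mer_top (p : puncture) : product_group :=
  match p with
  | pa | pb => merE p
  | pc | pd => (muE * merE p * muE^-1)%g
  end.

Definition incl_bottom : sphere_group -> product_group := pres_lift merE.
Definition incl_top : sphere_group -> product_group := pres_lift mer_top.

Lemma product_bacd : (merE pb * merE pa = merE pc * merE pd)%g.
Proof. by rewrite /merE /pres_gen !pres_piM; apply/presP/(pres_rel rel_bottom). Qed.

Lemma product_torus : (muE * lambdaE = lambdaE * muE)%g.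
Proof.
have -> : lambdaE = \pi_product_group [:: (gen_mer pb, true); (gen_mer pa, true)].
  exact: pres_piM.
rewrite [LHS]pres_piM [RHS]pres_piM; apply/presP; exact: (pres_rel rel_torus).
Qed.

Lemma incl_bottom_rel r : sphere_rel r -> weval merE r.1 = weval merE r.2.
Proof. by case; rewrite /= !mulg1; exact: product_bacd. Qed.

Lemma incl_top_rel r : sphere_rel r -> weval mer_top r.1 = weval mer_top r.2.
Proof.
case; rewrite /= !mulg1 !mulgA mulgVK -/lambdaE.
by rewrite -[(muE * _ * _)%g]mulgA -product_bacd -/lambdaE product_torus mulgK.
Qed.

Lemma incl_bottom_morphism : monoid.monoid_morphism incl_bottom.
Proof. exact: pres_lift_morphism incl_bottom_rel. Qed.

Lemma incl_top_morphism : monoid.monoid_morphism incl_top.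
Proof. exact: pres_lift_morphism incl_top_rel. Qed.

Lemma incl_bottom_mer p : incl_bottom (mer p) = merE p.
Proof. exact: pres_lift_gen incl_bottom_rel _. Qed.

Lemma incl_top_mer p : incl_top (mer p) = mer_top p.
Proof. exact: pres_lift_gen incl_top_rel _. Qed.

Section PerturbedRepresentations.
Variable R : realType.

Definition meridians_traceless : set (sphere_group -> SU2 R) :=
  [set rho | forall p, traceless (rho (mer p))].

Definition perturbed (f : R -> R) : set (product_group -> SU2 R) :=
  [set rho | (forall p, traceless (rho (merE p))) /\
    forall (alpha : R) (Q : quat R), imag_unit Q ->
      val (rho lambdaE) = qexp (alpha *: Q) ->
      val (rho muE) = qexp (f alpha *: Q)].

(* R(S^2, {a,b,c,d}) *)
Definition R_sphere : topologicalType := rep_space meridians_traceless.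
(* R_delta(S^2 x I, {a,b,c,d} x I), for delta = (E, f) *)
Definition R_pert (f : R -> R) : topologicalType := rep_space (perturbed f).

Lemma bottom_traceless f (rho : product_group -> SU2 R) :
  monoid.monoid_morphism rho -> perturbed f rho ->
  meridians_traceless (rho \o incl_bottom).
Proof. by move=> _ [h _] p /=; rewrite incl_bottom_mer. Qed.

Lemma top_traceless f (rho : product_group -> SU2 R) :
  monoid.monoid_morphism rho -> perturbed f rho ->
  meridians_traceless (rho \o incl_top).
Proof.
move=> rhoM [h _] p /=; rewrite incl_top_mer.
have rhoV : rho muE^-1%g = ((rho muE)^-1)%g.
  by apply: (mulgI (rho muE)); rewrite -rhoM.2 !mulgV rhoM.1.
by case: p; rewrite //= !rhoM.2 rhoV; exact: traceless_conj.
Qed.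

Definition restrict_bottom f : R_pert f -> R_sphere :=
  restrict incl_bottom_morphism (@bottom_traceless f).
Definition restrict_top f : R_pert f -> R_sphere :=
  restrict incl_top_morphism (@top_traceless f).

(* Restriction to R(S^2 x {0,1}, {a,b,c,d} x {0,1}), a product because
   S^2 x {0,1} has two components. *)
Definition restrict_ends f (x : R_pert f) : R_sphere * R_sphere :=
  (restrict_bottom x, restrict_top x).

Definition pillow_gens (gamma theta : R) (p : puncture) : SU2 R :=
  match p with
  | pa => SU2_i R
  | pb => SU2_expk gamma * SU2_i R
  | pc => SU2_expk theta * SU2_i R
  | pd => SU2_expk (theta - gamma) * SU2_i R
  end%g.

Lemma pillow_gens_rel gamma theta r : sphere_rel r ->
  weval (pillow_gens gamma theta) r.1 = weval (pillow_gens gamma theta) r.2.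
Proof.
case; rewrite /= !mulg1; apply: val_inj; rewrite !val_SU2M /= !qexp_kE.
have h := cos2Dsin2 theta; rewrite cosB sinB.
congr (_, _, _, _) => /=.
- by transitivity (- (cos gamma * (cos theta ^+ 2 + sin theta ^+ 2)));
    [rewrite h|]; ring.
- ring.
- ring.
- by transitivity (- (sin gamma * (cos theta ^+ 2 + sin theta ^+ 2)));
    [rewrite h|]; ring.
Qed.

Lemma pillow_gens_traceless gamma theta p :
  traceless (pillow_gens gamma theta p).
Proof.
by case: p; rewrite /traceless //= qexp_kE /qre /=; ring.
Qed.

Local Lemma pillow_rep_subproof gamma theta :
  rep_set meridians_traceless (pres_lift (pillow_gens gamma theta)).
Proof.
split; first exact: pres_lift_morphism (@pillow_gens_rel gamma theta).
move=> p; rewrite (pres_lift_gen (@pillow_gens_rel gamma theta)).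
exact: pillow_gens_traceless.
Qed.

Definition pillow_rep (gamma theta : R) : reps meridians_traceless :=
  mkrep (pillow_rep_subproof gamma theta).

(* The identification of P with R(S^2, {a,b,c,d}) *)
Definition pillow_to_R (p : pillowcase R) : R_sphere :=
  rep_class (pillow_rep (repr p).1 (repr p).2).

Local Lemma pillow_gens_2pi gamma theta p :
  pillow_gens (gamma + 2 * pi) theta p = pillow_gens gamma theta p /\
  pillow_gens gamma (theta + 2 * pi) p = pillow_gens gamma theta p.
Proof.
have e t : SU2_expk (t + 2 * pi) = SU2_expk t :> SU2 R.
  by apply: val_inj; rewrite /= !qexp_kE mulr_natl cosD2pi sinD2pi.
case: p; rewrite /pillow_gens; split.
- by [].
- by [].
- by rewrite e.
- by [].
- by [].
- by rewrite e.
- by congr (_ * _)%g; rewrite -e; congr SU2_expk; ring.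
- by congr (_ * _)%g; rewrite -[RHS]e; congr SU2_expk; ring.
Qed.

Local Lemma pillow_gens_opp gamma theta p :
  pillow_gens (- gamma) (- theta) p =
  (SU2_i R * pillow_gens gamma theta p * (SU2_i R)^-1)%g.
Proof.
have e t : (SU2_expk (- t) * SU2_i R = SU2_i R * SU2_expk t)%g.
  apply: val_inj; rewrite !val_SU2M /= !qexp_kE cosN sinN.
  by congr (_, _, _, _) => /=; ring.
case: p => /=; rewrite ?mulgA ?mulgK // -?e //.
by rewrite -[- theta - - gamma]opprD e.
Qed.

Lemma pillow_rep_eq x y : pillow_eq x y ->
  conjugate (val (pillow_rep x.1 x.2)) (val (pillow_rep y.1 y.2)).
Proof.
have step g (x' y' : R * R) : (forall p, pillow_gens y'.1 y'.2 p =
      g * pillow_gens x'.1 x'.2 p * g^-1)%g ->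
    conjugate (val (pillow_rep x'.1 x'.2)) (val (pillow_rep y'.1 y'.2)).
  by move=> h; exists g => w; exact: (weval_conj h).
elim=> {x y} [x y [] |x|x y _|x y z _ + _].
- apply: (step 1%g) => p /=.
  by rewrite (pillow_gens_2pi _ _ _).1 mul1g invg1 mulg1.
- apply: (step 1%g) => p /=.
  by rewrite (pillow_gens_2pi _ _ _).2 mul1g invg1 mulg1.
- by apply: (step (SU2_i R)) => p; exact: pillow_gens_opp.
- by exists 1%g => w; rewrite mul1g invg1 mulg1.
- by move/conjugate_sym.
- move=> [g hg] [h hh]; exists (h * g)%g => w.
  by rewrite hh hg invgM !mulgA.
Qed.

Lemma pillow_to_R_pillow gamma theta :
  pillow_to_R (pillow gamma theta) = rep_class (pillow_rep gamma theta).
Proof.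
apply/rep_classP/(@pillow_rep_eq _ (gamma, theta))/pillowP.
by rewrite /pillow -surjective_pairing reprK.
Qed.

(* The choice of representative is immaterial when f is odd and 2 pi-periodic *)
Definition c_delta (f : R -> R) (p : pillowcase R) : pillowcase R :=
  pillow (repr p).1 ((repr p).2 + 2 * f ((repr p).1 + pi)).

End PerturbedRepresentations.

(* Main.v *)
Require Import Defs.
From Stdlib Require Import Relation_Operators.
From mathcomp Require Import all_boot all_order all_algebra.
From mathcomp Require Import generic_quotient ring lra.
From mathcomp Require Import all_classical all_reals all_analysis.

(** The pillowcase is compact, being the image of a square of side [2 pi].  A
    continuous surjection from a compact space onto a space carrying a
    continuous map to a Hausdorff space is a homeomorphism as soon as the
    composite is injective ([compact_homeomorphism]).  Both identifications,
    [P = R(S^2, {a,b,c,d})] and [P = R_delta], are obtained in this way.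

    - Continuity: the images of the generators depend continuously on
      [(gamma, theta)], hence so does the image of every word.
    - Injectivity: the real parts of [ba], [ca] and [da] are invariant under
      conjugation and equal to [- cos gamma], [- cos theta] and
      [- cos (theta - gamma)]; these three numbers determine
      [(gamma, theta)] modulo the pillowcase group ([cos_pillow_eq]).
    - Surjectivity: a traceless representation can be conjugated so that [a]
      goes to [i] and the image of [b] lies in the plane of [i] and [j].
      Since [d = c^-1 b a] is traceless, the image of [c] then lies in that
      plane too, up to a further rotation about [i] when [b] goes to [i] or
      [-i] ([traceless_normal_form]).

    For [R_delta], the longitude [ba] goes to [e^{(gamma + pi) k}], so the
    perturbation condition says that [mu_E] goes to [e^{f(gamma + pi) k}]
    ([pert_mu]); conversely this value satisfies the condition for every
    choice of logarithm of the longitude, because [f] is odd and periodic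
    ([pert_condition]).  Conjugating [c] and [d] by it adds
    [2 f(gamma + pi)] to [theta], which gives the restriction to the top.

    The map [c_delta f] is covered by the shear
    [(gamma, theta) |-> (gamma, theta + 2 f(gamma + pi))] of the plane, with
    inverse the shear of [- f]; it fixes the corners because [f] vanishes at
    the multiples of [pi].  Joint continuity of the isotopy descends from
    [R x R^2] to [R x P] because the projection of the plane onto the
    pillowcase is open ([pillow_proj_nbhs]). *)

Set Implicit Arguments.
Unset Strict Implicit.
Unset Printing Implicit Defensive.

Import Order.TTheory GRing.Theory Num.Theory.
Import numFieldNormedType.Exports.

Local Open Scope classical_set_scope.
Local Open Scope quotient_scope.
Local Open Scope ring_scope.

(** * General topology *)

(** Surjectivity of [g] makes [tau] injective, so that a subset of [Y] is the
    preimage of its image in [Z]; no separation axiom on [Y] is required. *)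
Lemma compact_homeomorphism (X Y Z : topologicalType) (g : X -> Y)
    (tau : Y -> Z) :
  compact [set: X] -> hausdorff_space Z -> continuous g -> continuous tau ->
  injective (tau \o g) -> (forall y, exists x, g x = y) -> homeomorphism g.
Proof.
move=> cX hZ cg ctau inj surj; split=> //.
have [h gh] := choice surj.
have hg : cancel g h by move=> x; apply: inj; rewrite /= gh.
exists h; split=> //; apply/continuous_closedP => A cA.
have -> : h @^-1` A = tau @^-1` ((tau \o g) @` A).
  apply/seteqP; split=> y /=; first by move=> Ahy; exists (h y); rewrite ?gh.
  by move=> [x Ax]; rewrite -{1}(gh y) => /inj <-.
apply: (continuous_closedP _).1 => //; apply: compact_closed => //.
apply: continuous_compact; last exact: subclosed_compact cX _.
apply: continuous_subspaceT => x.
by apply: continuous_comp; [exact: cg|exact: ctau].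
Qed.

Lemma continuous_ptws (T : topologicalType) (I : eqType) (V : topologicalType)
    (g : T -> {ptws I -> V}) :
  (forall i, continuous (fun t => g t i)) -> continuous g.
Proof.
move=> cg x; apply/cvg_sup => i; move: x.
apply/(@continuousP _ (initial_topology (@^~ i))) => A [B oB E].
by rewrite -E; exact: (continuousP _).1 (cg i) _ oB.
Qed.

Lemma continuous_set_type (T X : topologicalType) (A : set X) (g : T -> A) :
  continuous (fun t => val (g t)) -> continuous g.
Proof. exact: continuous_comp_initial. Qed.

Lemma set_val_continuous (X : topologicalType) (A : set X) :
  continuous (val : A -> X).
Proof. exact: initial_continuous. Qed.

Lemma continuous_pair (T U V : topologicalType) (g : T -> U) (h : T -> V) :
  continuous g -> continuous h -> continuous (fun x => (g x, h x)).
Proof. by move=> cg ch x; apply: cvg_pair; [exact: cg|exact: ch]. Qed.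

Lemma continuous_fst (U V : topologicalType) : continuous (@fst U V).
Proof. by move=> x; exact: cvg_fst. Qed.

Lemma continuous_snd (U V : topologicalType) : continuous (@snd U V).
Proof. by move=> x; exact: cvg_snd. Qed.

(** * Continuity of quaternion operations *)

Section SU2Topology.
Variables (R : realType) (T : topologicalType).

Lemma continuous_quat (g : T -> quat R) :
  continuous (fun t => qre (g t)) -> continuous (fun t => qim_i (g t)) ->
  continuous (fun t => qim_j (g t)) -> continuous (fun t => qim_k (g t)) ->
  continuous g.
Proof.
move=> c1 c2 c3 c4.
have -> : g = fun t => (qre (g t), qim_i (g t), qim_j (g t), qim_k (g t)).
  by apply/funext => t; case: (g t) => [[[]]].
by repeat apply: continuous_pair.
Qed.

Lemma continuous_coord (g : T -> quat R) : continuous g ->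
  [/\ continuous (fun t => qre (g t)), continuous (fun t => qim_i (g t)),
      continuous (fun t => qim_j (g t)) & continuous (fun t => qim_k (g t))].
Proof.
move=> cg.
have c1 : continuous (fun t => (g t).1).
  by move=> x; apply: continuous_comp (cg x) _; exact: continuous_fst.
have c2 : continuous (fun t => (g t).1.1).
  by move=> x; apply: continuous_comp (c1 x) _; exact: continuous_fst.
split=> x.
- by apply: continuous_comp (c2 x) _; exact: continuous_fst.
- by apply: continuous_comp (c2 x) _; exact: continuous_snd.
- by apply: continuous_comp (c1 x) _; exact: continuous_snd.
- by apply: continuous_comp (cg x) _; exact: continuous_snd.
Qed.

Lemma continuous_qmul (p q : T -> quat R) :
  continuous p -> continuous q -> continuous (fun t => qmul (p t) (q t)).
Proof.
move=> /continuous_coord[p1 p2 p3 p4] /continuous_coord[q1 q2 q3 q4].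
have -> : (fun t => qmul (p t) (q t)) = (fun t => mkquat
  (qre (p t) * qre (q t) - qim_i (p t) * qim_i (q t)
   - qim_j (p t) * qim_j (q t) - qim_k (p t) * qim_k (q t))
  (qre (p t) * qim_i (q t) + qim_i (p t) * qre (q t)
   + qim_j (p t) * qim_k (q t) - qim_k (p t) * qim_j (q t))
  (qre (p t) * qim_j (q t) - qim_i (p t) * qim_k (q t)
   + qim_j (p t) * qre (q t) + qim_k (p t) * qim_i (q t))
  (qre (p t) * qim_k (q t) + qim_i (p t) * qim_j (q t)
   - qim_j (p t) * qim_i (q t) + qim_k (p t) * qre (q t))).
  by apply/funext => t; case: (p t) => [[[? ?] ?] ?]; case: (q t) => [[[? ?] ?] ?].
have cM (u v : T -> R) : continuous u -> continuous v ->
    continuous (fun t => u t * v t).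
  by move=> cu cv x; apply: cvgM; [exact: cu|exact: cv].
have cD (u v : T -> R) : continuous u -> continuous v ->
    continuous (fun t => u t + v t).
  by move=> cu cv x; apply: cvgD; [exact: cu|exact: cv].
have cB (u v : T -> R) : continuous u -> continuous v ->
    continuous (fun t => u t - v t).
  by move=> cu cv x; apply: cvgB; [exact: cu|exact: cv].
apply: continuous_quat.
- exact: cB _ _ (cB _ _ (cB _ _ (cM _ _ p1 q1) (cM _ _ p2 q2)) (cM _ _ p3 q3))
    (cM _ _ p4 q4).
- exact: cB _ _ (cD _ _ (cD _ _ (cM _ _ p1 q2) (cM _ _ p2 q1)) (cM _ _ p3 q4))
    (cM _ _ p4 q3).
- exact: cD _ _ (cD _ _ (cB _ _ (cM _ _ p1 q3) (cM _ _ p2 q4)) (cM _ _ p3 q1))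
    (cM _ _ p4 q2).
- exact: cD _ _ (cB _ _ (cD _ _ (cM _ _ p1 q4) (cM _ _ p2 q3)) (cM _ _ p3 q2))
    (cM _ _ p4 q1).
Qed.

Lemma continuous_SU2M (g h : T -> SU2 R) :
  continuous g -> continuous h -> continuous (fun t => (g t * h t)%g).
Proof.
move=> cg ch; apply: continuous_set_type.
apply: (@continuous_qmul (fun t => val (g t)) (fun t => val (h t))) => x.
  by apply: continuous_comp (cg x) _; exact: set_val_continuous.
by apply: continuous_comp (ch x) _; exact: set_val_continuous.
Qed.

Lemma continuous_SU2V (g : T -> SU2 R) :
  continuous g -> continuous (fun t => (g t)^-1%g).
Proof.
move=> cg; apply: continuous_set_type.
have /continuous_coord[g1 g2 g3 g4] : continuous (fun t => val (g t)).
  by move=> x; apply: continuous_comp (cg x) _; exact: set_val_continuous.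
have -> : (fun t => val (g t)^-1%g) = (fun t => mkquat (qre (val (g t)))
    (- qim_i (val (g t))) (- qim_j (val (g t))) (- qim_k (val (g t)))).
  by apply/funext => t; rewrite val_SU2V; case: (val (g t)) => [[[? ?] ?] ?].
have cN (u : T -> R) : continuous u -> continuous (fun t => - u t).
  by move=> cu x; apply: cvgN; exact: cu.
by apply: continuous_quat; rewrite /mkquat /qre /qim_i /qim_j /qim_k //=; exact: cN.
Qed.

Lemma continuous_SU2_expk (u : T -> R) :
  continuous u -> continuous (fun t => SU2_expk (u t)).
Proof.
move=> cu; apply: continuous_set_type.
have -> : (fun t => val (SU2_expk (u t))) =
    (fun t => mkquat (cos (u t)) 0 0 (sin (u t))).
  by apply/funext => t; rewrite /= qexp_kE.
apply: continuous_quat; rewrite /mkquat /qre /qim_i /qim_j /qim_k /=.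
- by move=> x; apply: continuous_comp (cu x) _; exact: continuous_cos.
- by move=> x; exact: cvg_cst.
- by move=> x; exact: cvg_cst.
- by move=> x; apply: continuous_comp (cu x) _; exact: continuous_sin.
Qed.

Lemma continuous_pres_lift (S : choiceType) (rels : set (word S * word S))
    (g : T -> S -> SU2 R) (x : presented rels) :
  (forall s, continuous (fun t => g t s)) ->
  continuous (fun t => pres_lift (g t) x).
Proof.
move=> cg; rewrite /pres_lift; elim: (repr x) => [|[s b] u IH] /=.
  by move=> t; exact: cvg_cst.
by apply: continuous_SU2M => //; case: b => //=; apply: continuous_SU2V.
Qed.

End SU2Topology.

(** * Trigonometry *)

Section Trigonometry.
Variable R : realType.
Implicit Types (a b x y : R).

Lemma sin_intpi (m : int) : sin (m%:~R * pi) = 0 :> R.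
Proof.
have nat_case (n : nat) : sin (n%:R * pi) = 0 :> R.
  elim: n => [|n IH]; first by rewrite mul0r sin0.
  by rewrite -natr1 mulrDl mul1r sinDpi IH oppr0.
case: m => n; first exact: nat_case.
by rewrite NegzE mulrNz mulNr sinN nat_case oppr0.
Qed.

Lemma sin_eq0P x : sin x = 0 -> exists m : int, x = m%:~R * pi.
Proof.
move=> sx; have p0 := pi_gt0 R.
exists (Num.floor (x / pi)); set m := Num.floor _.
have : sin (x - m%:~R * pi) = 0 by rewrite sinB sx sin_intpi mul0r mulr0 subr0.
have /andP[] := floor_itv (x / pi); rewrite -/m intrD mulr1z.
rewrite ler_pdivlMr // ltr_pdivrMr // mulrDl mul1r => h1 h2.
move: h1; rewrite le_eqVlt => /orP[/eqP//|h1].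
have : 0 < sin (x - m%:~R * pi) by apply: sin_gt0_pi; lra.
by move=> /[swap] ->; rewrite ltxx.
Qed.

Lemma cos_eqP a b : cos a = cos b ->
  exists m : int, a = b + m%:~R * (2 * pi) \/ a = - b + m%:~R * (2 * pi).
Proof.
move=> e.
have : sin ((a + b) / 2) * sin ((a - b) / 2) = 0.
  have eb : b = (a + b) / 2 - (a - b) / 2 by field.
  have ea : a = (a + b) / 2 + (a - b) / 2 by field.
  by move: e; rewrite [in LHS]ea [in RHS]eb cosD cosB; lra.
move/eqP; rewrite mulf_eq0 => /orP[] /eqP /sin_eq0P[m h]; exists m;
  [right|left]; lra.
Qed.

Lemma periodic_int (f : R -> R) x (m : int) :
  (forall y, f (y + 2 * pi) = f y) -> f (x + m%:~R * (2 * pi)) = f x.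
Proof.
move=> fp; have nat_case (n : nat) y : f (y + n%:R * (2 * pi)) = f y.
  elim: n => [|n IH]; first by rewrite mul0r addr0.
  by rewrite -IH -[RHS]fp; congr f; rewrite -natr1; ring.
case: m => n; first exact: nat_case.
by rewrite NegzE mulrNz mulNr -{2}(subrK (n.+1%:R * (2 * pi)) x) nat_case.
Qed.

Lemma cosDintpi x (m : int) : cos (x + m%:~R * (2 * pi)) = cos x.
Proof. by apply: periodic_int => y; rewrite mulr_natl cosD2pi. Qed.

Lemma sinDintpi x (m : int) : sin (x + m%:~R * (2 * pi)) = sin x.
Proof. by apply: periodic_int => y; rewrite mulr_natl sinD2pi. Qed.

End Trigonometry.

(** * The pillowcase *)

Section PillowcaseTopology.
Variable R : realType.
Implicit Types x y : R * R.

(** The elements of the group generated by the two translations and by [-1]: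
    a sign [(-1)^s] followed by a translation. *)
Definition pillow_move (s : bool) (m n : int) (x : R * R) : R * R :=
  ((-1) ^+ s * x.1 + m%:~R * (2 * pi), (-1) ^+ s * x.2 + n%:~R * (2 * pi)).

Lemma pillow_eqP x y :
  pillow_eq x y <-> exists s m n, y = pillow_move s m n x.
Proof.
split.
  elim=> {x y} [x y [] |x|x y _ [s [m [n ->]]]
    |x y z _ [s [m [n ->]]] _ [s' [m' [n' ->]]]].
  - by exists false, 1, 0; rewrite /pillow_move !expr0 !mul1r mul0r addr0.
  - by exists false, 0, 1; rewrite /pillow_move !expr0 !mul1r mul0r addr0.
  - by exists true, 0, 0; rewrite /pillow_move !expr1 !mulN1r mul0r !addr0.
  - exists false, 0, 0; rewrite /pillow_move !expr0 !mul1r mul0r !addr0.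
    exact: surjective_pairing.
  - exists s, (- (-1) ^+ s * m), (- (-1) ^+ s * n).
    rewrite [LHS]surjective_pairing /pillow_move /=; case: s => /=.
      by congr (_, _); rewrite !expr1 opprK mul1r; ring.
    by congr (_, _); rewrite !expr0 !mulN1r mulrNz; ring.
  - exists (s (+) s'), ((-1) ^+ s' * m + m'), ((-1) ^+ s' * n + n').
    rewrite /pillow_move /=; congr (_, _);
      rewrite rmorphD rmorphM rmorphXn /= mulrN1z;
      by case: s; case: s' => /=; ring.
have stepE (n : nat) (a : R) :
    a + n.+1%:R * (2 * pi) = a + n%:R * (2 * pi) + 2 * pi.
  by rewrite -natr1; ring.
have trans1 (n : nat) (z : R * R) : pillow_eq z (z.1 + n%:R * (2 * pi), z.2).
  elim: n => [|n IH].
    by rewrite mul0r addr0 -surjective_pairing; exact: rst_refl.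
  apply: rst_trans IH _; rewrite stepE.
  by apply: rst_step; exact: (@pillow_fst _ (_, _)).
have trans2 (n : nat) (z : R * R) : pillow_eq z (z.1, z.2 + n%:R * (2 * pi)).
  elim: n => [|n IH].
    by rewrite mul0r addr0 -surjective_pairing; exact: rst_refl.
  apply: rst_trans IH _; rewrite stepE.
  by apply: rst_step; exact: (@pillow_snd _ (_, _)).
have ztrans1 (n : int) (z : R * R) : pillow_eq z (z.1 + n%:~R * (2 * pi), z.2).
  case: n => n; first exact: trans1.
  apply: rst_sym; rewrite NegzE mulrNz mulNr.
  have := trans1 n.+1 (z.1 - n.+1%:R * (2 * pi), z.2).
  by rewrite /= subrK -surjective_pairing.
have ztrans2 (n : int) (z : R * R) : pillow_eq z (z.1, z.2 + n%:~R * (2 * pi)).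
  case: n => n; first exact: trans2.
  apply: rst_sym; rewrite NegzE mulrNz mulNr.
  have := trans2 n.+1 (z.1, z.2 - n.+1%:R * (2 * pi)).
  by rewrite /= subrK -surjective_pairing.
move=> [s [m [n ->]]].
apply: (@rst_trans _ _ _ ((-1) ^+ s * x.1, (-1) ^+ s * x.2)); last first.
  exact: rst_trans (ztrans1 m _) (ztrans2 n _).
case: s; last by rewrite !expr0 !mul1r -surjective_pairing; exact: rst_refl.
by rewrite !expr1 !mulN1r; apply: rst_step; exact: pillow_opp.
Qed.

(** The three cosines separate the points of the pillowcase. *)
Lemma cos_pillow_eq x y : cos x.1 = cos y.1 -> cos x.2 = cos y.2 ->
  cos (x.2 - x.1) = cos (y.2 - y.1) -> pillow_eq x y.
Proof.
have flip (a : R) : sin a = 0 -> exists k : int, - a = a + k%:~R * (2 * pi).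
  by move=> /sin_eq0P[k ->]; exists (- k); rewrite mulrNz; ring.
move=> e1 e2 e; apply/pillow_eqP; rewrite [y]surjective_pairing /pillow_move.
(* each coordinate is determined up to sign; when the two signs differ, the
   third cosine forces sin x.1 * sin x.2 = 0, and one sign can be changed *)
have [m d1] := cos_eqP (esym e1); have [n d2] := cos_eqP (esym e2).
case: d1 => h1; case: d2 => h2.
- by exists false, m, n; rewrite !expr0 !mul1r h1 h2.
- have : sin x.1 * sin x.2 = 0.
    by move: e; rewrite h1 h2 !cosB !cosDintpi !sinDintpi cosN sinN; lra.
  move/eqP; rewrite mulf_eq0 => /orP[] /eqP /flip[k hk].
    exists true, (m - k), n; rewrite !expr1 !mulN1r h1 h2 hk intrD mulrNz.
    by congr (_, _); ring.
  exists false, m, (n + k); rewrite !expr0 !mul1r h1 h2 hk intrD.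
  by congr (_, _); ring.
- have : sin x.1 * sin x.2 = 0.
    by move: e; rewrite h1 h2 !cosB !cosDintpi !sinDintpi cosN sinN; lra.
  move/eqP; rewrite mulf_eq0 => /orP[] /eqP /flip[k hk].
    exists false, (m + k), n; rewrite !expr0 !mul1r h1 h2 hk intrD.
    by congr (_, _); ring.
  exists true, m, (n - k); rewrite !expr1 !mulN1r h1 h2 hk intrD mulrNz.
  by congr (_, _); ring.
- by exists true, m, n; rewrite !expr1 !mulN1r h1 h2.
Qed.

(** The quotient map from the plane onto the pillowcase *)
Definition pillow_proj (x : R * R) : pillowcase R := pillow x.1 x.2.

Lemma pillow_projE x : pillow_proj x = \pi_(pillowcase R) x.
Proof. by rewrite /pillow_proj /pillow -surjective_pairing. Qed.

Lemma pillow_proj_surj (p : pillowcase R) : exists x, p = pillow_proj x.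
Proof. by exists (repr p); rewrite pillow_projE reprK. Qed.

Lemma pillow_proj_continuous : continuous pillow_proj.
Proof.
have -> : pillow_proj = \pi_(pillowcase R).
  by apply/funext => x; exact: pillow_projE.
exact: pi_continuous.
Qed.

Lemma pillow_continuous (Z : topologicalType) (g : pillowcase R -> Z) :
  continuous (g \o pillow_proj) -> continuous g.
Proof.
move=> cg; apply/quotient_continuous.
have <- // : g \o pillow_proj = g \o \pi_(quotient_topology (pillowcase R)).
by apply/funext => x /=; rewrite pillow_projE.
Qed.

Lemma pillow_move_continuous s m n : continuous (pillow_move s m n).
Proof.
apply: continuous_pair => x.
- by apply: cvgD; [apply: cvgM; [exact: cvg_cst|exact: cvg_fst]|exact: cvg_cst].
- by apply: cvgD; [apply: cvgM; [exact: cvg_cst|exact: cvg_snd]|exact: cvg_cst].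
Qed.

(** The projection is open, because its fibres are the orbits of a group of
    homeomorphisms of the plane. *)
Lemma pillow_proj_nbhs x (U : set (R * R)) :
  nbhs x U -> nbhs (pillow_proj x) (pillow_proj @` U).
Proof.
rewrite {1}nbhsE => -[V [oV Vx] VU].
apply: (@filterS _ _ _ (pillow_proj @` V)); first exact: image_subset.
apply: open_nbhs_nbhs; split; last by exists x.
rewrite /open /= /quotient_open openE => z [u Vu].
rewrite -pillow_projE /interior => /esym/pillowP/pillow_eqP[s [m [n e]]].
have nV : nbhs z (pillow_move s m n @^-1` V).
  by apply: pillow_move_continuous; rewrite -e; exact: open_nbhs_nbhs.
apply: filterS nV => w Vw /=.
exists (pillow_move s m n w) => //; rewrite -pillow_projE.
by apply/esym/pillowP/pillow_eqP; exists s, m, n.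
Qed.

Lemma pillowcase_compact : compact [set: pillowcase R].
Proof.
have -> : [set: pillowcase R] = pillow_proj @` (`[0, 2 * pi] `*` `[0, 2 * pi]).
  apply/seteqP; split=> // p _; have [x ->] := pillow_proj_surj p.
  have p0 : 0 < 2 * pi :> R by have := pi_gt0 R; lra.
  have box (a : R) : exists m : int, `[0, 2 * pi]%classic (a + m%:~R * (2 * pi)).
    exists (- Num.floor (a / (2 * pi))); rewrite mulrNz; set m := Num.floor _.
    have /andP[] := floor_itv (a / (2 * pi)); rewrite -/m intrD mulr1z.
    rewrite ler_pdivlMr // ltr_pdivrMr // mulrDl mul1r => h1 h2.
    by rewrite /= in_itv /=; lra.
  have [m hm] := box x.1; have [n hn] := box x.2.
  exists (pillow_move false m n x); first by rewrite /pillow_move !expr0 !mul1r.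
  by apply/esym/pillowP/pillow_eqP; exists false, m, n.
apply: continuous_compact; first exact/continuous_subspaceT/pillow_proj_continuous.
by apply: compact_setX; exact: segment_compact.
Qed.

End PillowcaseTopology.

(** * The map [c_delta] and its isotopy *)

Section Shear.
Variable R : realType.
Implicit Types (f : R -> R) (x : R * R).

(** The map of the plane that covers [c_delta f] *)
Definition shear f x : R * R := (x.1, x.2 + 2 * f (x.1 + pi)).

Lemma c_delta_pillow f (gamma theta : R) :
    (forall a, f (- a) = - f a) -> (forall a, f (a + 2 * pi) = f a) ->
  c_delta f (pillow gamma theta) = pillow gamma (theta + 2 * f (gamma + pi)).
Proof.
move=> fN fp.
suff shear_eq x y : pillow_eq x y -> pillow_eq (shear f x) (shear f y).
  apply: (pillowP (_, _) (_, _)).2; apply: (shear_eq (repr _) (gamma, theta)).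
  by apply/pillowP; rewrite /pillow -surjective_pairing reprK.
elim=> {x y} [x y [] |x|x y _|x y z _ + _]; last 3 first.
- exact: rst_refl.
- exact: rst_sym.
- exact: rst_trans.
- rewrite /shear /= (_ : x.1 + 2 * pi + pi = x.1 + pi + 2 * pi) ?fp; last by ring.
  by apply: rst_step; exact: (@pillow_fst _ (_, _)).
- rewrite /shear /= addrAC.
  by apply: rst_step; exact: (@pillow_snd _ (_, _)).
- rewrite /shear /= (_ : f (- x.1 + pi) = - f (x.1 + pi)); last first.
    rewrite -fN -[RHS]fp; congr f; ring.
  by rewrite mulrN -opprD; apply: rst_step; exact: (@pillow_opp _ (_, _)).
Qed.

Lemma c_delta_proj f x :
    (forall a, f (- a) = - f a) -> (forall a, f (a + 2 * pi) = f a) ->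
  c_delta f (pillow_proj x) = pillow_proj (shear f x).
Proof. exact: c_delta_pillow. Qed.

Lemma shear_continuous f : continuous f -> continuous (shear f).
Proof.
move=> cf; apply: continuous_pair => x; first exact: cvg_fst.
apply: cvgD; first exact: cvg_snd.
apply: cvgM; first exact: cvg_cst.
apply: (@continuous_comp _ _ _ (fun x : R * R => x.1 + pi) f); last exact: cf.
by apply: cvgD; [exact: cvg_fst|exact: cvg_cst].
Qed.

Lemma c_delta_continuous f :
    (forall a, f (- a) = - f a) -> (forall a, f (a + 2 * pi) = f a) ->
  continuous f -> continuous (c_delta f).
Proof.
move=> fN fp cf; apply: pillow_continuous.
rewrite (_ : _ \o _ = @pillow_proj R \o shear f); last first.
  by apply/funext => x /=; exact: c_delta_proj.
move=> x; apply: continuous_comp; first exact: shear_continuous.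
exact: pillow_proj_continuous.
Qed.

Lemma c_deltaK f :
    (forall a, f (- a) = - f a) -> (forall a, f (a + 2 * pi) = f a) ->
  cancel (c_delta f) (c_delta (fun a => - f a)).
Proof.
move=> fN fp p; have [x ->] := pillow_proj_surj p.
rewrite c_delta_proj // c_delta_proj => [|a|a]; rewrite ?fN ?fp //.
rewrite [RHS]/pillow_proj [LHS]/pillow_proj /=.
by rewrite mulrN addrK.
Qed.

Lemma c_delta_homeomorphism f :
    (forall a, f (- a) = - f a) -> (forall a, f (a + 2 * pi) = f a) ->
  continuous f -> homeomorphism (c_delta f).
Proof.
move=> fN fp cf.
have gN a : - f (- a) = - - f a by rewrite fN.
have gp a : - f (a + 2 * pi) = - f a by rewrite fp.
split; first exact: c_delta_continuous.
exists (c_delta (fun a => - f a)); split.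
- by apply: c_delta_continuous => // x; apply: cvgN; exact: cf.
- exact: c_deltaK.
- move=> p; rewrite -[RHS](c_deltaK gN gp); congr c_delta.
  by apply/funext => a; rewrite opprK.
Qed.

Lemma is_diff_shear (a b1 b2 c : R) f x :
    derivable f (x.1 + pi) 1 ->
  is_diff x (fun y : R * R => (a * y.1 + b1, a * y.2 + b2 + c * f (y.1 + pi)))
    (fun v => (a * v.1, a * v.2 + (c * derive1 f (x.1 + pi)) * v.1)).
Proof.
move=> df.
have d1 : is_diff x (fst : R * R -> R) fst.
  apply: DiffDef; first by apply: linear_differentiable; exact: continuous_fst.
  by rewrite diff_lin //; exact: continuous_fst.
have d2 : is_diff x (snd : R * R -> R) snd.
  apply: DiffDef; first by apply: linear_differentiable; exact: continuous_snd.
  by rewrite diff_lin //; exact: continuous_snd.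
have d3 : is_diff ((fst + cst pi : R * R -> R) x) f
    (fun h => h * derive1 f (x.1 + pi)).
  apply: DiffDef; first exact/derivable1_diffP.
  by rewrite deriv1E.
apply: (@is_diff_eq _ _ _ _ _ _ _ (is_diff_pair
  (is_diffD (is_diffZ a d1) (is_diff_cst b1 x))
  (is_diffD (is_diffD (is_diffZ a d2) (is_diff_cst b2 x))
     (is_diffZ c (is_diff_comp (is_diffD d1 (is_diff_cst pi x)) d3))))).
apply/funext => v; rewrite /= !addr0; congr (_, _).
rewrite -mulrA; congr (_ + _ * _).
by rewrite mulrC.
Qed.

(** This family of maps is stable under directional differentiation: the
    derivative in the direction [v] is the member with parameters
    [0], [a * v.1], [a * v.2], [c * v.1] and [k + 1]. *)
Lemma shear_Ck (f : R -> R) (U : set (R * R)) (n k : nat) (a b1 b2 c : R) :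
    (forall (m : nat) (z : R), derivable (derive1n m f) z 1) ->
  Ck_on n U (fun x : R * R =>
    (a * x.1 + b1, a * x.2 + b2 + c * derive1n k f (x.1 + pi))).
Proof.
move=> fd; elim: n k a b1 b2 c => [|n IH] k a b1 b2 c.
all: set F := (X in Ck_on _ _ X).
all: have Fd x : is_diff x F
    (fun v => (a * v.1, a * v.2 + (c * derive1n k.+1 f (x.1 + pi)) * v.1))
  by exact: is_diff_shear.
- move=> x _; apply: differentiable_continuous; exact: @ex_diff _ _ _ _ _ _ (Fd x).
- split=> [x _|v]; first exact: @ex_diff _ _ _ _ _ _ (Fd x).
  have -> : (fun x => 'd F x v) = (fun x => (0 * x.1 + a * v.1,
      0 * x.2 + a * v.2 + (c * v.1) * derive1n k.+1 f (x.1 + pi))).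
    apply/funext => x; have -> := @diff_val _ _ _ _ _ _ _ (Fd x); rewrite /=.
    by congr (_, _); ring.
  exact: IH.
Qed.

Lemma odd_periodic_intpi f (m : int) :
    (forall a, f (- a) = - f a) -> (forall a, f (a + 2 * pi) = f a) ->
  f (m%:~R * pi) = 0.
Proof.
move=> fN fp; have nat_case (j : nat) : f (j%:R * pi) = 0.
  elim/ltn_ind: j => -[|[|j]] IH.
  - by rewrite mul0r; have := fN 0; rewrite oppr0; lra.
  - rewrite mul1r; have := fp (- pi).
    by rewrite (_ : - pi + 2 * pi = pi) ?fN; [lra|ring].
  - rewrite (_ : j.+2%:R * pi = j%:R * pi + 2 * pi) ?fp ?IH //.
    by rewrite -2!natr1; ring.
case: m => j; first exact: nat_case.
by rewrite NegzE mulrNz mulNr fN nat_case oppr0.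
Qed.

Lemma c_delta_corner f p :
    (forall a, f (- a) = - f a) -> (forall a, f (a + 2 * pi) = f a) ->
  corner p -> c_delta f p = p.
Proof.
move=> fN fp [m [n ->]]; rewrite c_delta_pillow //.
rewrite (_ : _ + pi = (m + 1)%:~R * pi); last by rewrite intrD; ring.
by rewrite odd_periodic_intpi // mulr0 addr0.
Qed.

Lemma c_delta_smooth f :
    (forall a, f (- a) = - f a) -> (forall a, f (a + 2 * pi) = f a) ->
    (forall (n : nat) (z : R), derivable (derive1n n f) z 1) ->
  smooth_off_corners (c_delta f).
Proof.
move=> fN fp fd x; rewrite -/(pillow_proj x) => xc.
have gN a : - f (- a) = - - f a by rewrite fN.
have gp a : - f (a + 2 * pi) = - f a by rewrite fp.
split.
  (* a point sent to a corner is the image of that corner under the inverse,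
     which fixes the corners *)
  move=> cc; apply: xc; rewrite -[pillow_proj _](c_deltaK fN fp).
  by rewrite (c_delta_corner gN gp cc).
exists setT, (shear f); split=> //; first exact: openT.
  move=> n; have := shear_Ck setT n 0 1 0 0 2 fd.
  congr Ck_on; apply/funext => y.
  by rewrite /shear !mul1r !addr0.
by move=> y _; rewrite -[LHS]/(pillow_proj (shear f y)) -c_delta_proj.
Qed.

Lemma c_delta_isotopy f :
    (forall a, f (- a) = - f a) -> (forall a, f (a + 2 * pi) = f a) ->
  continuous f ->
  isotopy idfun (c_delta f) (fun t : R => c_delta (fun a => t * f a)).
Proof.
move=> fN fp cf.
have tN t a : t * f (- a) = - (t * f a) by rewrite fN mulrN.
have tp t a : t * f (a + 2 * pi) = t * f a by rewrite fp.
split.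
- apply: continuous_subspaceT => -[t p]; have [x ->] := pillow_proj_surj p => N.
  rewrite nbhs_simpl /= c_delta_proj // => nN.
  (* K is the isotopy read on R x R^2 *)
  pose K (z : R * (R * R)) := pillow_proj (shear (fun a => z.1 * f a) z.2).
  have cK : continuous K.
    have cz2 : continuous (fun z : R * (R * R) => z.2) by move=> z; exact: cvg_snd.
    have cz21 : continuous (fun z : R * (R * R) => z.2.1).
      by move=> z; apply: continuous_comp (cz2 z) _; exact: cvg_fst.
    have cz22 : continuous (fun z : R * (R * R) => z.2.2).
      by move=> z; apply: continuous_comp (cz2 z) _; exact: cvg_snd.
    move=> z; apply: (@continuous_comp _ _ _ (fun z : R * (R * R) =>
      (z.2.1, z.2.2 + 2 * (z.1 * f (z.2.1 + pi))))); last first.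
      exact: pillow_proj_continuous.
    apply: continuous_pair => // {}z.
    apply: cvgD; first exact: cz22.
    apply: cvgM; first exact: cvg_cst.
    apply: cvgM; first exact: cvg_fst.
    apply: (@continuous_comp _ _ _ (fun z : R * (R * R) => z.2.1 + pi) f);
      last exact: cf.
    by apply: cvgD; [exact: cz21|exact: cvg_cst].
  have [[A B] [/= nA nB] AB] : nbhs (t, x) (K @^-1` N) by exact: cK.
  exists (A, @pillow_proj R @` B); first by split=> //; exact: pillow_proj_nbhs.
  move=> [s q] [/= As [y By <-]].
  by rewrite c_delta_proj //; exact: (AB (s, y)).
- move=> t _; apply: c_delta_homeomorphism => // x.
  by apply: cvgM; [exact: cvg_cst|exact: cf].
- apply/funext => p; have [x ->] := pillow_proj_surj p.
  by rewrite c_delta_proj // /shear mul0r mulr0 addr0 -surjective_pairing.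
- by congr c_delta; apply/funext => a; rewrite mul1r.
Qed.

End Shear.

(** * Normal form of traceless representations *)

Section NormalForm.
Variable R : realType.
Implicit Types (a b c d g v : SU2 R).

Lemma circle_angle (x y : R) : x ^+ 2 + y ^+ 2 = 1 ->
  exists t, x = cos t /\ y = sin t.
Proof.
move=> h; have x1 : -1 <= x <= 1.
  have := sqr_ge0 y; move=> y2; apply/andP; split; nra.
have xi : x \in `[(-1), 1] by rewrite in_itv.
have e : Num.sqrt (1 - x ^+ 2) = `|y|.
  by rewrite (_ : 1 - x ^+ 2 = y ^+ 2) ?sqrtr_sqr //; lra.
have [y0|y0] := leP 0 y.
  by exists (acos x); rewrite acosK // sin_acos // e ger0_norm.
by exists (- acos x); rewrite cosN sinN acosK // sin_acos // e ltr0_norm // opprK.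
Qed.

(** Polar coordinates with angle [2 t], written in [cos t] and [sin t] because
    conjugation by [e^{t i}] or [e^{t k}] is a rotation by [2 t]. *)
Lemma half_angle (x y : R) : exists s t, [/\ 0 <= s, s ^+ 2 = x ^+ 2 + y ^+ 2,
  x = s * (cos t ^+ 2 - sin t ^+ 2) & y = s * (2 * cos t * sin t)].
Proof.
have r0 : 0 <= x ^+ 2 + y ^+ 2 by rewrite addr_ge0 ?sqr_ge0.
pose s := Num.sqrt (x ^+ 2 + y ^+ 2).
have sge0 : 0 <= s by exact: sqrtr_ge0.
have s2 : s ^+ 2 = x ^+ 2 + y ^+ 2 by rewrite sqr_sqrtr.
have [s0|s0] := eqVneq s 0.
  have h : x ^+ 2 + y ^+ 2 == 0 by rewrite -s2 s0 expr0n.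
  move: h; rewrite paddr_eq0 ?sqr_ge0 // !sqrf_eq0 => /andP[/eqP x0 /eqP y0].
  by exists s, 0; rewrite s2 s0 x0 y0 !mul0r.
have [|t [ht1 ht2]] := @circle_angle (x / s) (y / s).
  by rewrite !expr_div_n -mulrDl -s2 divff // expf_neq0.
exists s, (t / 2); split=> //.
  have -> : x = s * (x / s) by field.
  rewrite ht1 {1}(_ : t = t / 2 + t / 2) ?cosD; last by field.
  by rewrite !expr2.
have -> : y = s * (y / s) by field.
rewrite ht2 {1}(_ : t = t / 2 + t / 2) ?sinD; last by field.
by ring.
Qed.

Lemma expi_norm (t : R) : qnormsq (mkquat (cos t) (sin t) 0 0) = 1.
Proof. by rewrite /qnormsq /qre /qim_i /qim_j /qim_k /= -(cos2Dsin2 t); ring. Qed.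

(** The unit quaternion [e^{t i}] *)
Definition SU2_expi (t : R) : SU2 R := mkSU2 (expi_norm t).

Lemma tracelessE v : traceless v ->
  val v = mkquat 0 (qim_i (val v)) (qim_j (val v)) (qim_k (val v)).
Proof.
by rewrite /traceless; case: (val v) => [[[? ?] ?] ?]; rewrite /qre /= => ->.
Qed.

Lemma traceless_norm v : traceless v ->
  qim_i (val v) ^+ 2 + qim_j (val v) ^+ 2 + qim_k (val v) ^+ 2 = 1.
Proof. by move=> v0; have := SU2P v; rewrite /qnormsq v0 expr0n /= add0r. Qed.

Lemma conj_expi v t : traceless v ->
  val (SU2_expi (- t) * v * (SU2_expi (- t))^-1)%g = mkquat 0 (qim_i (val v))
    ((cos t ^+ 2 - sin t ^+ 2) * qim_j (val v) + 2 * cos t * sin t * qim_k (val v))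
    ((cos t ^+ 2 - sin t ^+ 2) * qim_k (val v) - 2 * cos t * sin t * qim_j (val v)).
Proof.
move=> /tracelessE e; rewrite !val_SU2M val_SU2V {1}e.
move: (qim_i _) (qim_j _) (qim_k _) => {e} x y z; rewrite /= cosN sinN.
congr (_, _, _, _); try ring.
by rewrite -[RHS]mul1r -[in RHS](cos2Dsin2 t); ring.
Qed.

Lemma conj_expk v t : traceless v ->
  val (SU2_expk (- t) * v * (SU2_expk (- t))^-1)%g = mkquat 0
    ((cos t ^+ 2 - sin t ^+ 2) * qim_i (val v) + 2 * cos t * sin t * qim_j (val v))
    ((cos t ^+ 2 - sin t ^+ 2) * qim_j (val v) - 2 * cos t * sin t * qim_i (val v))
    (qim_k (val v)).
Proof.
move=> /tracelessE e; rewrite !val_SU2M val_SU2V {1}e.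
move: (qim_i _) (qim_j _) (qim_k _) => {e} x y z; rewrite /= !qexp_kE cosN sinN /=.
congr (_, _, _, _); try ring.
by rewrite -[RHS]mul1r -[in RHS](cos2Dsin2 t); ring.
Qed.

Lemma conj_expi_i t : (SU2_expi (- t) * SU2_i R * (SU2_expi (- t))^-1)%g = SU2_i R.
Proof.
apply: val_inj; rewrite conj_expi // /qi /mkquat /qim_i /qim_j /qim_k /=.
by congr (_, _, _, _); ring.
Qed.

Lemma conj_to_i v : traceless v -> exists g, (g * v * g^-1)%g = SU2_i R.
Proof.
move=> v0; have [s [t [_ _ ej ek]]] := half_angle (qim_j (val v)) (qim_k (val v)).
(* a rotation about i moves v to the plane of i and j, then a rotation about k
   moves it to i *)
pose w := (SU2_expi (- t) * v * (SU2_expi (- t))^-1)%g.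
have w0 : traceless w by exact: traceless_conj.
have wk : qim_k (val w) = 0 by rewrite conj_expi // ej ek /qim_k /=; ring.
have [r [u [r0 r2 ei' ej']]] := half_angle (qim_i (val w)) (qim_j (val w)).
have r1 : r = 1.
  apply/eqP; rewrite -sqrp_eq1 // r2.
  by have := traceless_norm w0; rewrite wk expr0n addr0 => ->.
exists (SU2_expk (- u) * SU2_expi (- t))%g.
have -> : (SU2_expk (- u) * SU2_expi (- t) * v *
    (SU2_expk (- u) * SU2_expi (- t))^-1 =
    SU2_expk (- u) * w * (SU2_expk (- u))^-1)%g by rewrite /w invgM !mulgA.
apply: val_inj; rewrite conj_expk // ei' ej' wk r1 /= /qi /mkquat.
congr (_, _, _, _); last by ring.
by rewrite -[RHS](expr1n _ 2) -[in RHS](cos2Dsin2 u); ring.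
Qed.

Lemma planar_expk v : traceless v -> qim_k (val v) = 0 ->
  exists t, v = (SU2_expk t * SU2_i R)%g.
Proof.
move=> v0 vk; have [|t [ei ej]] := @circle_angle (qim_i (val v)) (qim_j (val v)).
  by have := traceless_norm v0; rewrite vk expr0n addr0.
exists t; apply: val_inj; rewrite (tracelessE v0) vk ei ej !val_SU2M /= qexp_kE.
by rewrite /qi /mkquat /=; congr (_, _, _, _); ring.
Qed.

(** The real part of [c^-1 b i] is, up to sign, the determinant of the
    components of [b] and [c] orthogonal to [i]. *)
Lemma conj_planar b c : traceless b -> traceless c ->
    traceless (c^-1 * b * SU2_i R)%g ->
  exists g, [/\ (g * SU2_i R * g^-1)%g = SU2_i R,
    qim_k (val (g * b * g^-1)%g) = 0 & qim_k (val (g * c * g^-1)%g) = 0].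
Proof.
move=> b0 c0 d0.
(* when b is i or - i, it stays put and c is rotated instead *)
have [bjk|bjk] := pselect (qim_j (val b) = 0 /\ qim_k (val b) = 0).
  have [s [t [_ _ ej ek]]] := half_angle (qim_j (val c)) (qim_k (val c)).
  exists (SU2_expi (- t)); split; first exact: conj_expi_i.
    by rewrite conj_expi // bjk.1 bjk.2 /qim_k /=; ring.
  by rewrite conj_expi // ej ek /qim_k /=; ring.
have [s [t [_ s2 ej ek]]] := half_angle (qim_j (val b)) (qim_k (val b)).
exists (SU2_expi (- t)); split; first exact: conj_expi_i.
  by rewrite conj_expi // ej ek /qim_k /=; ring.
have s0 : s != 0.
  by apply/negP => /eqP s0; apply: bjk; rewrite ej ek s0 !mul0r.
rewrite conj_expi // [LHS]/qim_k /=.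
(* tracelessness of c^-1 b i *)
have : qim_k (val b) * qim_j (val c) - qim_j (val b) * qim_k (val c) = 0.
  rewrite -[RHS]d0 !val_SU2M val_SU2V (tracelessE c0) (tracelessE b0).
  by rewrite /qre/qim_j/qim_k /=; ring.
rewrite ej ek => h; apply: (mulfI s0); rewrite mulr0 -[RHS]oppr0 -[in RHS]h.
by rewrite /qim_k/qim_j; ring.
Qed.

Lemma traceless_normal_form (rho : puncture -> SU2 R) :
    (forall p, traceless (rho p)) -> (rho pb * rho pa = rho pc * rho pd)%g ->
  exists g gamma theta, forall p,
    pillow_gens gamma theta p = (g * rho p * g^-1)%g.
Proof.
move=> tr rel; have [g1 e1] := conj_to_i (tr pa).
pose sigma p := (g1 * rho p * g1^-1)%g.
have sa : sigma pa = SU2_i R by [].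
have sM : (sigma pb * SU2_i R = sigma pc * sigma pd)%g.
  rewrite -sa /sigma !mulgA !mulgVK -[(g1 * _ * rho pa)%g]mulgA rel.
  by rewrite !mulgA.
have str p : traceless (sigma p) by exact: traceless_conj.
have sd : ((sigma pc)^-1 * sigma pb * SU2_i R = sigma pd)%g.
  by rewrite -mulgA sM mulKg.
have [|g [ga gb gc]] := conj_planar (str pb) (str pc); first by rewrite sd.
have [gamma eb] := planar_expk (traceless_conj g (str pb)) gb.
have [theta ec] := planar_expk (traceless_conj g (str pc)) gc.
exists (g * g1)%g, gamma, theta.
have gE p : (g * g1 * rho p * (g * g1)^-1 = g * sigma p * g^-1)%g.
  by rewrite /sigma invgM !mulgA.
move=> p; rewrite gE; case: p.
- by rewrite sa ga.
- by rewrite eb.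
- by rewrite ec.
- have := pillow_gens_rel gamma theta rel_bacd; rewrite /= !mulg1 => h.
  apply: (mulgI (SU2_expk theta * SU2_i R)%g).
  transitivity (g * (sigma pb * SU2_i R) * g^-1)%g.
    by rewrite -[LHS]h -eb -[in LHS]ga !mulgA !mulgVK.
  by rewrite sM -[in RHS]ec !mulgA !mulgVK.
Qed.

End NormalForm.

(** * Spaces of representations *)

Lemma monoid_morphismV (H G : groupType) (phi : H -> G) x :
  monoid.monoid_morphism phi -> phi x^-1%g = (phi x)^-1%g.
Proof.
by move=> phiM; apply: (mulgI (phi x)); rewrite -phiM.2 !mulgV phiM.1.
Qed.

Section MorphismsFromPresentation.
Variables (S : choiceType) (rels : set (word S * word S)) (G : groupType).
Variable rho : presented rels -> G.
Hypothesis rhoM : monoid.monoid_morphism rho.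

(** A homomorphism is determined by its values on the generators. *)
Lemma pres_hom_lift x : rho x = pres_lift (fun s => rho (pres_gen rels s)) x.
Proof.
rewrite /pres_lift -{1}(reprK x); elim: (repr x) => [|[s b] u IH] /=.
  exact: rhoM.1.
rewrite -IH -(cat1s (s, b) u) -pres_piM rhoM.2; congr (_ * _)%g.
case: b => //; rewrite -monoid_morphismV //; congr rho.
apply: (mulgI (pres_gen rels s)); rewrite mulgV /pres_gen pres_piM.
by apply/presP; exact: pres_cancel.
Qed.

End MorphismsFromPresentation.

Section RepSpaceTopology.
Variables (R : realType) (G : groupType) (C : set (G -> SU2 R)).

Lemma continuous_reps (T : topologicalType) (g : T -> reps C) :
  (forall x, continuous (fun t => val (g t) x)) -> continuous g.
Proof. by move=> cg; apply: continuous_set_type; exact: continuous_ptws. Qed.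

Lemma reps_eval_continuous x : continuous (fun rho : reps C => val rho x : SU2 R).
Proof.
move=> rho; apply: (@continuous_comp _ _ _ (val : reps C -> {ptws G -> SU2 R})
  (fun h : {ptws G -> SU2 R} => h x)); first exact: set_val_continuous.
exact: (@proj_continuous G (fun=> SU2 R) x).
Qed.

Lemma rep_class_continuous : continuous (@rep_class R G C).
Proof. exact: pi_continuous. Qed.

Lemma rep_space_continuous (Z : topologicalType) (g : rep_space C -> Z) :
  continuous (g \o @rep_class R G C) -> continuous g.
Proof. by move=> cg; apply/quotient_continuous. Qed.

(** The character of a class of representations, up to a factor 2: the real
    part is half the trace and does not depend on the representative. *)
Definition rep_re (x : G) (c : rep_space C) : R := qre (val (val (repr c) x)).

Lemma qre_conj (g q : SU2 R) : qre (val (g * q * g^-1)%g) = qre (val q).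
Proof.
rewrite !val_SU2M val_SU2V -[RHS]mul1r.
have := SU2P g; move: (val g) (val q) => [[[w x] y] z] [[[a b] c] d].
by rewrite /qnormsq /qre /qim_i /qim_j /qim_k /= => <-; ring.
Qed.

Lemma rep_re_class x (rho : reps C) :
  rep_re x (rep_class rho) = qre (val (val rho x)).
Proof.
have [g h] := (rep_classP _ _).1 (rep_classK (rep_class rho)).
by rewrite h qre_conj.
Qed.

Lemma rep_re_continuous x : continuous (rep_re x).
Proof.
apply: rep_space_continuous.
rewrite (_ : _ \o _ = fun rho : reps C => qre (val (val rho x))); last first.
  by apply/funext => rho /=; exact: rep_re_class.
have ce : continuous (fun rho : reps C => val (val rho x : SU2 R)).
  move=> rho; apply: continuous_comp; first exact: reps_eval_continuous.
  exact: set_val_continuous.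
by have [] := continuous_coord ce.
Qed.

End RepSpaceTopology.

Lemma restrict_continuous (R : realType) (G H : groupType) (phi : G -> H)
    (C : set (G -> SU2 R)) (D : set (H -> SU2 R))
    (phiM : monoid.monoid_morphism phi)
    (phiC : forall rho, monoid.monoid_morphism rho -> D rho -> C (rho \o phi)) :
  continuous (Defs.restrict phiM phiC).
Proof.
apply: rep_space_continuous.
rewrite (_ : _ \o _ = (@rep_class _ _ _) \o rep_restrict phiM phiC); last first.
  by apply/funext => rho /=; exact: restrict_class.
move=> rho; apply: continuous_comp; last exact: rep_class_continuous.
by apply: continuous_reps => x {}rho; exact: reps_eval_continuous.
Qed.

(** * The pillowcase as the representation space of the sphere *)

Section SphereRepresentations.
Variable R : realType.
Implicit Types (gamma theta : R).

(** The characters of [ba], [ca] and [da] *)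
Definition sphere_invariants (c : R_sphere R) : R * R * R :=
  (rep_re (mer pb * mer pa)%g c, rep_re (mer pc * mer pa)%g c,
   rep_re (mer pd * mer pa)%g c).

Lemma sphere_invariants_continuous : continuous sphere_invariants.
Proof. by repeat apply: continuous_pair; exact: rep_re_continuous. Qed.

Lemma pillow_rep_mer gamma theta p :
  val (pillow_rep gamma theta) (mer p) = pillow_gens gamma theta p.
Proof. exact: pres_lift_gen (@pillow_gens_rel R gamma theta) _. Qed.

Lemma sphere_invariants_pillow gamma theta :
  sphere_invariants (pillow_to_R (pillow gamma theta)) =
  (- cos gamma, - cos theta, - cos (theta - gamma)).
Proof.
have re t : qre (val (SU2_expk t * SU2_i R * SU2_i R)%g) = - cos t.
  by rewrite !val_SU2M /= qexp_kE /qre /=; ring.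
rewrite pillow_to_R_pillow /sphere_invariants !rep_re_class.
have M := (repP (pillow_rep gamma theta)).1.
by rewrite !M.2 !pillow_rep_mer -!re.
Qed.

Lemma pillow_to_R_inj : injective (sphere_invariants \o @pillow_to_R R).
Proof.
move=> p q; have [x ->] := pillow_proj_surj p; have [y ->] := pillow_proj_surj q.
rewrite /= !sphere_invariants_pillow => -[/oppr_inj e1 /oppr_inj e2 /oppr_inj e3].
by apply/pillowP; exact: cos_pillow_eq.
Qed.

Lemma pillow_rep_continuous :
  continuous (fun x : R * R => pillow_rep x.1 x.2).
Proof.
apply: continuous_reps => w; apply: continuous_pres_lift.
have c1 : continuous (fun x : R * R => x.1) by move=> x; exact: cvg_fst.
have c2 : continuous (fun x : R * R => x.2) by move=> x; exact: cvg_snd.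
have ci : continuous (fun x : R * R => SU2_i R) by move=> x; exact: cvg_cst.
case=> //=; apply: continuous_SU2M => //; apply: continuous_SU2_expk => //.
by move=> x; apply: cvgB; [exact: c2|exact: c1].
Qed.

Lemma pillow_to_R_continuous : continuous (@pillow_to_R R).
Proof.
apply: pillow_continuous.
rewrite (_ : _ \o _ = (@rep_class _ _ _) \o (fun x : R * R => pillow_rep x.1 x.2)).
  move=> x; apply: continuous_comp; first exact: pillow_rep_continuous.
  exact: rep_class_continuous.
by apply/funext => x /=; exact: pillow_to_R_pillow.
Qed.

Lemma pillow_to_R_surj (c : R_sphere R) : exists p, pillow_to_R p = c.
Proof.
rewrite -(rep_classK c); move: (repr c) => rho.
have [rhoM tr] := repP rho.
have [|g [gamma [theta e]]] := traceless_normal_form tr.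
  rewrite -!rhoM.2; congr (val rho _); rewrite /mer /pres_gen !pres_piM.
  exact/presP/(pres_rel rel_bacd).
exists (pillow gamma theta); rewrite pillow_to_R_pillow.
apply/esym/rep_classP; exists g => w.
by rewrite (pres_hom_lift rhoM); exact: weval_conj.
Qed.

Lemma pillow_to_R_homeomorphism : homeomorphism (@pillow_to_R R).
Proof.
apply: (compact_homeomorphism (tau := sphere_invariants)).
- exact: pillowcase_compact.
- exact: norm_hausdorff.
- exact: pillow_to_R_continuous.
- exact: sphere_invariants_continuous.
- exact: pillow_to_R_inj.
- exact: pillow_to_R_surj.
Qed.

End SphereRepresentations.

(** * Perturbed representations *)

Section PerturbedRepresentations.
Variables (R : realType) (f : R -> R).
Hypothesis f_odd : forall a, f (- a) = - f a.
Hypothesis f_periodic : forall a, f (a + 2 * pi) = f a.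

(** The values on the generators of the perturbed representation that extends
    [pillow_rep gamma theta]. *)
Definition pert_gens (gamma theta : R) (s : generator) : SU2 R :=
  match s with
  | gen_mer p => pillow_gens gamma theta p
  | gen_mu => SU2_expk (f (gamma + pi))
  end.

Lemma pillow_gens_ba (gamma theta : R) :
  (pillow_gens gamma theta pb * pillow_gens gamma theta pa =
   SU2_expk (gamma + pi))%g.
Proof.
apply: val_inj; rewrite !val_SU2M /= !qexp_kE cosDpi sinDpi /qi /mkquat /=.
by congr (_, _, _, _); ring.
Qed.

Lemma SU2_expkC (s t : R) : (SU2_expk s * SU2_expk t = SU2_expk t * SU2_expk s)%g.
Proof.
by apply: val_inj; rewrite !val_SU2M /= !qexp_kE /=; congr (_, _, _, _); ring.
Qed.

Lemma pert_gens_rel gamma theta r : product_rel r ->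
  weval (pert_gens gamma theta) r.1 = weval (pert_gens gamma theta) r.2.
Proof.
case; first exact: (pillow_gens_rel gamma theta rel_bacd).
have ba := pillow_gens_ba gamma theta; rewrite /= in ba.
by rewrite /= !mulg1 [RHS]mulgA ba SU2_expkC.
Qed.

Lemma pert_lift_lambda gamma theta :
  pres_lift (pert_gens gamma theta) lambdaE = SU2_expk (gamma + pi).
Proof.
have M := pres_lift_morphism (@pert_gens_rel gamma theta).
rewrite M.2 !(pres_lift_gen (@pert_gens_rel gamma theta)) /=.
exact: pillow_gens_ba gamma theta.
Qed.

(** If [e^{phi k} = e^{alpha Q}] then [alpha = s phi] modulo [2 pi] for some sign
    [s], hence [f alpha = s f phi].  Either [sin phi <> 0] and [Q = s k], or
    [phi] is a multiple of [pi] and [f phi = 0]. *)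
Lemma pert_condition (phi alpha : R) (Q : quat R) : imag_unit Q ->
  val (SU2_expk phi) = qexp (alpha *: Q) ->
  val (SU2_expk (f phi)) = qexp (f alpha *: Q).
Proof.
move=> hQ; rewrite /= !qexp_kE qexp_imag // [in X in _ -> X]qexp_imag //.
case: Q hQ => [[[w x] y] z] hQ; have w0 : w = 0 by exact: hQ.1.
rewrite {}w0 /= => -[ec ei ej ek].
have eca : cos alpha = cos phi.
  by rewrite ec /GRing.scale /=; ring.
have [m hm] := cos_eqP eca.
have key (s : R) : s ^+ 2 = 1 -> sin alpha = s * sin phi ->
    cos (f alpha) = cos (f phi) -> sin (f alpha) = s * sin (f phi) ->
  mkquat (cos (f phi)) 0 0 (sin (f phi)) =
  cos (f alpha) *: q1 R + sin (f alpha) *: ((0, x, y, z) : quat R).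
  move=> s2 sa ca sfa.
  have [sp|sp] := eqVneq (sin phi) 0.
    have [k hk] := sin_eq0P sp.
    have f0 : f phi = 0 by rewrite hk; exact: odd_periodic_intpi.
    by rewrite sfa ca f0 sin0 cos0 mulr0 scale0r addr0 scale1r.
  move: ei ej ek; rewrite /GRing.scale /= !mulr0 !add0r sa => ei ej ek.
  have s0 : s * sin phi != 0.
    by rewrite mulf_neq0 // -sqrf_eq0 s2 oner_neq0.
  have x0 : x = 0 by apply: (mulfI s0); rewrite mulr0 -ei.
  have y0 : y = 0 by apply: (mulfI s0); rewrite mulr0 -ej.
  have zs : z = s.
    apply: (mulfI s0); rewrite -ek -[LHS]mul1r -s2; ring.
  rewrite x0 y0 zs ca sfa /mkquat.
  congr (_, _, _, _);
    rewrite /= /GRing.scale /= ?mulr0 ?mulr1 ?addr0 ?add0r //.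
  by rewrite -[LHS]mul1r -s2; ring.
case: hm => hm.
  by apply: (key 1); rewrite ?expr1n ?mul1r // hm ?sinDintpi ?periodic_int.
by apply: (key (-1)); rewrite ?sqrrN ?expr1n ?mulN1r // hm ?sinDintpi ?sinN //
  (periodic_int _ _ f_periodic) f_odd ?cosN ?sinN.
Qed.

Lemma pert_rep_subproof gamma theta :
  rep_set (perturbed f) (pres_lift (pert_gens gamma theta)).
Proof.
have gensE := pres_lift_gen (@pert_gens_rel gamma theta).
split; first exact: pres_lift_morphism (@pert_gens_rel gamma theta).
split=> [p|alpha Q hQ].
  by rewrite [merE p]/(pres_gen _ _) gensE; exact: pillow_gens_traceless.
rewrite pert_lift_lambda [muE]/(pres_gen _ _) gensE.
exact: pert_condition.
Qed.

Definition pert_rep gamma theta : reps (perturbed f) :=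
  mkrep (pert_rep_subproof gamma theta).

Lemma val_pert_rep_gen gamma theta s :
  val (pert_rep gamma theta) (pres_gen product_rel s) = pert_gens gamma theta s.
Proof. exact: pres_lift_gen (@pert_gens_rel gamma theta) _. Qed.

Lemma qmulDl (p q r : quat R) : qmul (p + q) r = qmul p r + qmul q r.
Proof.
case: p => [[[p0 p2] p3] p4]; case: q => [[[x y] z] w].
case: r => [[[x' y'] z'] w'].
by congr (_, _, _, _); rewrite /=; ring.
Qed.

(** The axis [Q] is [u k u^-1]. *)
Lemma conj_expkE (u : SU2 R) : exists2 Q : quat R, imag_unit Q &
  forall t, val (u * SU2_expk t * u^-1)%g = qexp (t *: Q).
Proof.
pose K := mkSU2 (imag_unit_qk R).2.
have K0 : traceless K by [].
have hQ : imag_unit (val (u * K * u^-1)%g).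
  by split; [exact: traceless_conj|exact: SU2P].
exists (val (u * K * u^-1)%g) => // t.
rewrite (qexp_imag _ hQ) !val_SU2M /= qexp_imag; last exact: imag_unit_qk.
rewrite qmulDr qmulDl !qmulZr !qmulZl qmulq1; congr (_ *: _ + _).
exact: qmul_conjr (SU2P u).
Qed.

(** In a perturbed representation the image of [mu_E] is determined by that of
    the longitude; the conjugation by [g] puts the latter in the circle
    [e^{phi k}]. *)
Lemma pert_mu (rho : product_group -> SU2 R) (g : SU2 R) (phi : R) :
    perturbed f rho -> (SU2_expk phi = g * rho lambdaE * g^-1)%g ->
  (SU2_expk (f phi) = g * rho muE * g^-1)%g.
Proof.
move=> [_ pert] hl; have [Q hQ E] := conj_expkE g^-1%g.
have hl' : val (rho lambdaE) = qexp (phi *: Q).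
  rewrite -E hl invgK; congr val.
  by rewrite !mulgA mulVg mul1g mulgVK.
have hm : rho muE = (g^-1 * SU2_expk (f phi) * g)%g.
  by apply: val_inj; rewrite (pert _ _ hQ hl') -E invgK.
by rewrite hm !mulgA mulgV mul1g mulgK.
Qed.

(** The map from [P] to [R_delta] inverse to the restriction to the bottom *)
Definition pert_class (p : pillowcase R) : R_pert f :=
  rep_class (pert_rep (repr p).1 (repr p).2).

Lemma pert_class_pillow gamma theta :
  pert_class (pillow gamma theta) = rep_class (pert_rep gamma theta).
Proof.
set p := pillow gamma theta; set x := repr p.
have xp : pillow x.1 x.2 = pillow gamma theta.
  by rewrite /pillow -surjective_pairing reprK.
have [g hg] : conjugate (val (pillow_rep x.1 x.2)) (val (pillow_rep gamma theta)).
  by apply: (@pillow_rep_eq _ x (gamma, theta)); exact/pillowP.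
have hgen q : pillow_gens gamma theta q = (g * pillow_gens x.1 x.2 q * g^-1)%g.
  by rewrite -!pillow_rep_mer; exact: hg.
apply/rep_classP; exists g => w; apply: weval_conj => -[q|]; first exact: hgen.
have := @pert_mu (val (pert_rep x.1 x.2)) g (gamma + pi)
  (repP (pert_rep x.1 x.2)).2.
rewrite -[muE]/(pres_gen product_rel gen_mu) val_pert_rep_gen; apply.
have -> : val (pert_rep x.1 x.2) lambdaE = SU2_expk (x.1 + pi).
  exact: pert_lift_lambda.
rewrite -(pillow_gens_ba x.1 x.2) -(pillow_gens_ba gamma theta) !hgen.
by rewrite !mulgA mulgVK.
Qed.

Lemma restrict_bottom_pert p : restrict_bottom (pert_class p) = pillow_to_R p.
Proof.
have [x ->] := pillow_proj_surj p.
rewrite /pillow_proj pert_class_pillow pillow_to_R_pillow.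
rewrite /restrict_bottom restrict_class.
congr rep_class; apply: val_inj; apply/funext => w.
have M := (repP (rep_restrict incl_bottom_morphism (@bottom_traceless R f)
  (pert_rep x.1 x.2))).1.
rewrite (pres_hom_lift M) /=; congr (pres_lift _ w); apply/funext => q.
rewrite -[pres_gen _ _]/(mer q) incl_bottom_mer; exact: val_pert_rep_gen.
Qed.

Lemma restrict_top_pert p : restrict_top (pert_class p) = pillow_to_R (c_delta f p).
Proof.
have [x ->] := pillow_proj_surj p.
rewrite /pillow_proj c_delta_pillow // pert_class_pillow pillow_to_R_pillow.
rewrite /restrict_top restrict_class.
congr rep_class; apply: val_inj; apply/funext => w.
have M := (repP (rep_restrict incl_top_morphism (@top_traceless R f)
  (pert_rep x.1 x.2))).1.
rewrite (pres_hom_lift M) /=; congr (pres_lift _ w); apply/funext => q.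
rewrite -[pres_gen _ _]/(mer q) incl_top_mer.
have PM : monoid.monoid_morphism
    (pres_lift (rels := product_rel) (pert_gens x.1 x.2)).
  exact: (repP (pert_rep x.1 x.2)).1.
have muP : pres_lift (pert_gens x.1 x.2) muE = SU2_expk (f (x.1 + pi)).
  exact: (val_pert_rep_gen x.1 x.2 gen_mu).
have merP r : pres_lift (pert_gens x.1 x.2) (merE r) = pillow_gens x.1 x.2 r.
  exact: (val_pert_rep_gen x.1 x.2 (gen_mer r)).
have rot (s t : R) : (SU2_expk s * (SU2_expk t * SU2_i R) * (SU2_expk s)^-1 =
    SU2_expk (t + 2 * s) * SU2_i R)%g.
  apply: val_inj; rewrite !val_SU2M val_SU2V /= !qexp_kE /qi /mkquat /=.
  rewrite (_ : t + 2 * s = t + s + s); last by ring.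
  rewrite !(cosD, sinD).
  by congr (_, _, _, _); ring.
have conjP r : pres_lift (pert_gens x.1 x.2) (muE * merE r * muE^-1)%g =
    (SU2_expk (f (x.1 + pi)) * pillow_gens x.1 x.2 r *
     (SU2_expk (f (x.1 + pi)))^-1)%g.
  by rewrite !PM.2 (monoid_morphismV _ PM) muP merP.
case: q; rewrite ?merP //; rewrite conjP rot //.
by rewrite [x.2 - x.1 + _]addrAC.
Qed.

Lemma pert_class_surj (c : R_pert f) : exists p, pert_class p = c.
Proof.
rewrite -(rep_classK c); move: (repr c) => rho.
have [rhoM rhoP] := repP rho.
have [|g [gamma [theta e]]] := traceless_normal_form rhoP.1.
  by rewrite -!rhoM.2 product_bacd.
exists (pillow gamma theta); rewrite pert_class_pillow.
apply/esym/rep_classP; exists g => w.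
rewrite (pres_hom_lift rhoM); apply: weval_conj => -[q|]; first exact: e.
apply: (pert_mu rhoP); rewrite -(pillow_gens_ba gamma theta) !e /lambdaE rhoM.2.
by rewrite !mulgA mulgVK.
Qed.

Hypothesis f_continuous : continuous f.

Lemma pert_rep_continuous : continuous (fun x : R * R => pert_rep x.1 x.2).
Proof.
apply: continuous_reps => w; apply: continuous_pres_lift => -[q|] /=.
  move=> x; have c := @pillow_rep_continuous R.
  have -> : (fun x : R * R => pillow_gens x.1 x.2 q) =
      (fun x : R * R => val (pillow_rep x.1 x.2) (mer q)).
    by apply/funext => z; rewrite pillow_rep_mer.
  apply: (@continuous_comp _ _ _ (fun x : R * R => pillow_rep x.1 x.2)
    (fun r => val r (mer q))); first exact: c.
  exact: reps_eval_continuous.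
apply: continuous_SU2_expk => x.
apply: (@continuous_comp _ _ _ (fun x : R * R => x.1 + pi) f).
  by apply: cvgD; [exact: cvg_fst|exact: cvg_cst].
exact: f_continuous.
Qed.

Lemma pert_class_continuous : continuous pert_class.
Proof.
apply: pillow_continuous.
rewrite (_ : _ \o _ = (@rep_class _ _ _) \o (fun x : R * R => pert_rep x.1 x.2)).
  move=> x; apply: continuous_comp; first exact: pert_rep_continuous.
  exact: rep_class_continuous.
by apply/funext => x /=; exact: pert_class_pillow.
Qed.

Lemma pert_class_homeomorphism : homeomorphism pert_class.
Proof.
apply: (compact_homeomorphism
  (tau := @sphere_invariants R \o @restrict_bottom R f)).
- exact: pillowcase_compact.
- exact: norm_hausdorff.
- exact: pert_class_continuous.
- move=> c; apply: continuous_comp; first exact: restrict_continuous.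
  exact: sphere_invariants_continuous.
- by move=> p q; rewrite /= !restrict_bottom_pert => /pillow_to_R_inj.
- exact: pert_class_surj.
Qed.

End PerturbedRepresentations.

Theorem theorem9p1 (R : realType) (f : R -> R)
    (f_smooth : forall (n : nat) (x : R), derivable (derive1n n f) x 1)
    (f_odd : forall x : R, f (- x) = - f x)
    (f_periodic : forall x : R, f (x + 2 * pi) = f x) :
  [/\ homeomorphism (@pillow_to_R R),
      (exists iota : pillowcase R -> R_pert f,
        [/\ forall p, restrict_bottom (iota p) = pillow_to_R p,
            homeomorphism iota
          & forall p, restrict_ends (iota p) =
              (pillow_to_R p, pillow_to_R (c_delta f p))]),
      (forall gamma theta : R,
        c_delta f (pillow gamma theta) =
        pillow gamma (theta + 2 * f (gamma + pi))),
      homeomorphism (c_delta f) /\ smooth_off_corners (c_delta f)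
    & isotopy idfun (c_delta f) (fun t : R => c_delta (fun x => t * f x))].
Proof.
have cf : continuous f.
  move=> x; apply/differentiable_continuous/derivable1_diffP.
  exact: (f_smooth 0%N).
split.
- exact: pillow_to_R_homeomorphism.
- exists (pert_class f_odd f_periodic); split.
  + exact: restrict_bottom_pert.
  + exact: pert_class_homeomorphism.
  + by move=> p; rewrite /restrict_ends restrict_bottom_pert restrict_top_pert.
- by move=> gamma theta; exact: c_delta_pillow.
- by split; [exact: c_delta_homeomorphism|exact: c_delta_smooth].
- exact: c_delta_isotopy.
Qed.
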